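(* Let $\Gamma$ be a countable discrete abelian group with finite exponent, and write $$\Gamma = \bigoplus_{k=1}^M(\mathbb{Z}/r_k\mathbb{Z})^{m_k} \oplus \bigoplus_{j=1}^N\left( \bigoplus_{n=1}^{\infty}(\mathbb{Z}/q_j\mathbb{Z}) \right)$$ with $N\ge 1$, $M\ge 0$, $q_1, \dots, q_N, r_1, \dots, r_M$ distinct prime powers and $m_1, \dots, m_M \in \mathbb{N}$. Let $\Delta \le \Gamma$ be the finite index subgroup $$\Delta = \bigoplus_{j=1}^N\left( \bigoplus_{n=1}^{\infty}(\mathbb{Z}/q_j\mathbb{Z}) \right).$$ If $D_q$ is topologically Kronecker-generated for each $q \in \{q_1, \dots, q_N\}$, then there is a sequence $(r_n)_{n \in \mathbb{N}}$ in $\Gamma$ such that, for every $s \in \Delta$, $(r_n - s)_{n \in \mathbb{N}}$ is a freely rigid-recurrent sequence in $\Gamma$.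
   Context: For $q\ge2$, $\Lambda_q\subseteq\mathbb{C}$ is the group of $q$th roots of unity and $D_q=\prod_{n=1}^\infty\Lambda_q$ (product topology), the Pontryagin dual of $\bigoplus_{n=1}^\infty(\mathbb{Z}/q\mathbb{Z})$. A set $K\subseteq D_q$ is of type $K_q$ if for every continuous $f:K\to\Lambda_q$ there is $g\in\bigoplus_{n=1}^\infty(\mathbb{Z}/q\mathbb{Z})$ with $f(\chi)=\chi(g)$ for all $\chi\in K$. More generally, if $G$ is a compact metrizable abelian group with countable discrete dual $\hat G$ (so $G$ is the group of characters of $\hat G$), $K\subseteq G$ is a Kronecker set if for every continuous $f:K\to\mathbb{T}$ ($\mathbb{T}$ the unit circle) and every $\varepsilon>0$ there is $g\in\hat G$ with $\sup_{\chi\in K}|f(\chi)-\chi(g)|<\varepsilon$. A compact metrizable abelian group $G$ that has infinite exponent or is isomorphic to $D_q$ for some $q\ge2$ is topologically Kronecker-generated if there is a perfect set $K\subseteq G$ (closed, no isolated points) such that $K$ is a Kronecker set or a set of type $K_q$ and the subgroup $\langle K\rangle$ generated by $K$ is dense in $G$. A measure-preserving system (or action) for $\Gamma$ is a quadruple $(X, \mathcal{B}, \mu, (T_g)_{g \in \Gamma})$, where $(X,\mathcal{B},\mu)$ is a non-atomic Lebesgue probability space and $(T_g)_{g\in\Gamma}$ is an action of $\Gamma$ by measure-preserving transformations. A sequence $(a_n)$ in $\Gamma$ is a rigidity sequence for the system if $\|f\circ T_{a_n} - f\|_2 \to 0$ for every $f \in L^2(\mu)$. The system is free if $\mu(\{x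 : T_gx = x\}) = 0$ for every $g\in\Gamma\setminus\{0\}$. A set $R\subseteq\Gamma$ is a set of recurrence if for every measure-preserving system and every $A\in\mathcal{B}$ with $\mu(A)>0$ there is $r\in R\setminus\{0\}$ with $\mu(A\cap T_r^{-1}A)>0$. A sequence $(r_n)_{n\in\mathbb{N}}$ in $\Gamma$ is freely rigid-recurrent if it is a rigidity sequence for a free action of $\Gamma$ and $\{r_n : n\in\mathbb{N}\}$ is a set of recurrence. *)

(* Defs.v *)
From HB Require Import structures.
From mathcomp Require Import all_boot all_order all_algebra.
From mathcomp Require Import all_classical all_reals all_analysis.
From mathcomp Require Import complex.

Set Implicit Arguments.
Unset Strict Implicit.
Unset Printing Implicit Defensive.
Import Order.TTheory GRing.Theory Num.Theory.
Import numFieldNormedType.Exports.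
Local Open Scope classical_set_scope.
Local Open Scope ring_scope.

Section DirectSum.
Context (I : Type) (A : I -> zmodType).

Record dirsum : Type := DirSum {
  dscoord :> forall i, A i;
  dscoord_fin : finite_set [set i | dscoord i != 0] }.

Lemma dirsum_ext (x y : dirsum) : (forall i, x i = y i) -> x = y.
Proof.
case: x y => [x fx] [y fy] /= xy.
have {}xy : x = y by apply: functional_extensionality_dep.
by subst y; congr DirSum; exact: Prop_irrelevance.
Qed.

Fact dirsum0_fin : finite_set [set i | (0 : A i) != 0].
Proof.
by apply: (@sub_finite_set _ _ set0) (finite_set0 _) => i /=; rewrite eqxx.
Qed.

Fact dirsumN_fin (x : dirsum) : finite_set [set i | - x i != 0].
Proof.
by apply: sub_finite_set (dscoord_fin x) => i /=; rewrite oppr_eq0.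
Qed.

Fact dirsumD_fin (x y : dirsum) : finite_set [set i | x i + y i != 0].
Proof.
apply: (@sub_finite_set _ _ ([set i | x i != 0] `|` [set i | y i != 0])).
  move=> i /= xy0; case: (eqVneq (x i) 0) => [x0|]; last by left.
  by right; move: xy0; rewrite x0 add0r.
by rewrite finite_setU; split; exact: dscoord_fin.
Qed.

Definition dirsum0 : dirsum := DirSum dirsum0_fin.
Definition dirsumN (x : dirsum) : dirsum := DirSum (dirsumN_fin x).
Definition dirsumD (x y : dirsum) : dirsum := DirSum (dirsumD_fin x y).

HB.instance Definition _ := gen_eqMixin dirsum.
HB.instance Definition _ := gen_choiceMixin dirsum.

Fact dirsumDA : associative dirsumD.
Proof. by move=> x y z; apply: dirsum_ext => i /=; rewrite addrA. Qed.
Fact dirsumDC : commutative dirsumD.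
Proof. by move=> x y; apply: dirsum_ext => i /=; rewrite addrC. Qed.
Fact dirsum0D : left_id dirsum0 dirsumD.
Proof. by move=> x; apply: dirsum_ext => i /=; rewrite add0r. Qed.
Fact dirsumND : left_inverse dirsum0 dirsumN dirsumD.
Proof. by move=> x; apply: dirsum_ext => i /=; rewrite addNr. Qed.

HB.instance Definition _ :=
  GRing.isZmodule.Build dirsum dirsumDA dirsumDC dirsum0D dirsumND.

End DirectSum.

(* 'Z_q denotes Z/qZ only when 1 < q. *)
Definition dirsum_Z (q : nat) : zmodType := dirsum (fun _ : nat => 'Z_q).

Definition prime_power (n : nat) : Prop :=
  exists p k : nat, [/\ prime p, (0 < k)%N & n = (p ^ k)%N].

Section Kronecker.
Context (R : realType).
Local Notation C := (R[i]^o).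

(* A compact abelian group G is presented with its discrete dual Ghat through
   the duality pairing (chi, g) |-> chi(g). *)
Definition kronecker_set (G : topologicalType) (Ghat : Type)
    (pairing : G -> Ghat -> C) (K : set G) : Prop :=
  forall f : G -> C, {within K, continuous f} ->
    (forall chi, K chi -> `|f chi| = 1) ->
  forall e : R, 0 < e -> exists g : Ghat,
    (ereal_sup [set (complex.Re `|f chi - pairing chi g|)%:E | chi in K]
       < e%:E)%E.

Definition roots_of_unity (q : nat) : set C := [set z | z ^+ q = 1].

Definition Dq (q : nat) : set {ptws nat -> C} :=
  [set chi | forall n, roots_of_unity q (chi n)].

(* All but finitely many factors are 1, so this is a finite product. *)
Definition Dq_pairing (q : nat) (chi : {ptws nat -> C}) (g : dirsum_Z q) : C :=
  \big[*%R/1]_(n \in [set: nat]) chi n ^+ (g n).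

Definition type_Kq (q : nat) (K : set {ptws nat -> C}) : Prop :=
  forall f : {ptws nat -> C} -> C, {within K, continuous f} ->
    (forall chi, K chi -> roots_of_unity q (f chi)) ->
  exists g : dirsum_Z q, forall chi, K chi -> f chi = Dq_pairing chi g.

Definition Dq_subgroup (q : nat) (H : set {ptws nat -> C}) : Prop :=
  [/\ H `<=` Dq q, H (fun=> 1),
      (forall x y, H x -> H y -> H (fun n => x n * y n)) &
      (forall x, H x -> H (fun n => (x n)^-1))].

(* D_q is closed in C^nat, so closedness, isolated points and density for
   subsets of D_q may be computed in C^nat. *)
Definition Dq_kronecker_generated (q : nat) : Prop :=
  exists K : set {ptws nat -> C},
    [/\ K `<=` Dq q, perfect_set K,
        kronecker_set (@Dq_pairing q) K \/ type_Kq q K &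
        Dq q `<=` closure (smallest (Dq_subgroup q) K)].

End Kronecker.

Section Lebesgue.
Context (R : realType).

(* The type of [completed_lebesgue_measure]: R with its Lebesgue sigma-algebra. *)
Local Notation lebesgueR := (caratheodory_type (@wlength R idfun)^*%mu).

(* A complete probability space that is isomorphic modulo null sets to the unit
   interval with Lebesgue-measurable sets: a Lebesgue space in the sense of
   Rokhlin, without its atomic part. *)
Definition nonatomic_lebesgue_space d (X : measurableType d)
    (P : probability X R) : Prop :=
  measure_is_complete P /\
  exists (X0 : set X) (Y0 : set lebesgueR) (f : X -> lebesgueR),
    [/\ measurable X0 /\ P X0 = 1%E,
        [/\ measurable Y0, Y0 `<=` `[0, 1] &
            completed_lebesgue_measure Y0 = 1%E],
        set_bij X0 Y0 f,
        (forall A, A `<=` X0 -> measurable A <-> measurable (f @` A)) &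
        (forall A, A `<=` X0 -> measurable A ->
           P A = completed_lebesgue_measure (f @` A))].
End Lebesgue.

Section Dynamics.
Context (R : realType) (Gam : zmodType).

Record system : Type := System {
  sys_disp : measure_display;
  sys_space : measurableType sys_disp;
  prob : probability sys_space R;
  act : Gam -> sys_space -> sys_space;
  system_lebesgue : nonatomic_lebesgue_space prob;
  act0 : forall x, act 0 x = x;
  actD : forall g h x, act (g + h) x = act g (act h x);
  act_measurable : forall g, measurable_fun setT (act g);
  act_preserving : forall g (A : set sys_space), measurable A ->
    prob (act g @^-1` A) = prob A }.

(* L^2 is the space of real-valued functions; applying this to real and
   imaginary parts gives the condition for complex-valued functions. *)
Definition rigidity_sequence (S : system) (a : nat -> Gam) : Prop :=
  forall f : sys_space S -> R, f \in Lfun (prob S) 2%:E ->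
    ('N[prob S]_2%:E [EFin \o ((f \o act (a n)) \- f)%R])%E @[n --> \oo] --> 0%E.

(* The measure is complete and the space is countably separated modulo a null
   set, so the fixed-point sets are measurable and negligible means null. *)
Definition free_system (S : system) : Prop :=
  forall g : Gam, g != 0 -> (prob S).-negligible [set x : sys_space S | act g x = x].

Definition set_of_recurrence (E : set Gam) : Prop :=
  forall (S : system) (A : set (sys_space S)), measurable A -> (0 < prob S A)%E ->
    exists r : Gam, [/\ E r, r != 0 &
      (0 < prob S (A `&` act r @^-1` A))%E].

Definition freely_rigid_recurrent (a : nat -> Gam) : Prop :=
  (exists S : system, free_system S /\ rigidity_sequence S a) /\
  set_of_recurrence (range a).

End Dynamics.

(* Main.v *)
(**
Identify the infinite part of the group with the locally constant functions, with values
in the finite group Q = prod_j Z/q_j, on the boundary of a tree whose nodes are numbers: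
the value of g at a node y is the sum of the coordinates of g along the branch from the
root to y. The evaluations at the boundary points then form an independent set K of type
K_q that generates a dense subgroup.

Let s_0, s_1, ... enumerate the infinite part. The letters of a branch carry a label i
and a random bit, and the k-th stage is the finite set of all a such that, for every
j < k, a agrees with s_j at most branches whose last letters all have label j. The
sequence runs through the successive stages.

Recurrence: for i < k the set (stage k) - s_i contains a translate of a Hamming ball of
small relative radius in a large power of Q. By concentration of measure (Efron-Stein),
every set A of density at least 1/(k+1) has A - A meeting this translate.

Rigidity and freeness: for fixed i let the branches have label i eventually and uniform
random bits. Then g acts on [0, 1[, read as a sequence of digits (bit, z, f), by adding
to the coordinate z of the t-th digit the difference of g along two random branches. For
g in (stage k) - s_i each digit changes with small probability, so the maps converge to
the identity in measure; the triangular shape of the differences makes the action free.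
*)
Require Import Defs.
From HB Require Import structures.
From mathcomp Require Import all_boot all_order all_algebra.
From mathcomp Require Import all_classical all_reals all_analysis.
From mathcomp Require Import measurable_realfun simple_functions.
From mathcomp Require Import ring lra zify.
Set Implicit Arguments.
Unset Strict Implicit.
Unset Printing Implicit Defensive.
Import Order.TTheory GRing.Theory Num.Theory.
Import numFieldNormedType.Exports.

(** * Concentration of measure on a finite power of a finite group *)

Section Concentration.
Local Open Scope ring_scope.

Section CubeAverage.
Context (R : realFieldType) (Gam : zmodType) (Q : finZmodType).
Variable h : nat -> {additive Q -> Gam}.
Implicit Types (f : Gam -> R) (g t : Gam).

(** Mean of [f] over the points [g + \sum_(y < m) h y (v y)], with [v] uniform in [Q ^ m]. The
    recursion averages over one coordinate at a time, as the variance bound requires. *)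
Fixpoint cube_avg (m : nat) f g : R :=
  if m is m'.+1 then (#|Q|%:R)^-1 * \sum_q cube_avg m' f (g + h m' q) else f g.

Let cardQ_gt0 : 0 < (#|Q|%:R : R).
Proof. by rewrite ltr0n; apply/card_gt0P; exists 0. Qed.

Let avg_cst (c : R) : (#|Q|%:R)^-1 * (\sum_(q : Q) c) = c.
Proof.
by rewrite sumr_const -[c *+ _]mulr_natl mulrA mulVf ?mul1r// gt_eqF.
Qed.

Lemma cube_avg_le m f1 f2 g : (forall g, f1 g <= f2 g) ->
  cube_avg m f1 g <= cube_avg m f2 g.
Proof.
move=> f12; elim: m g => [|m IH] g //=.
by rewrite ler_pM2l ?invr_gt0// ler_sum.
Qed.

Lemma cube_avg_cst m c g : cube_avg m (fun=> c) g = c.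
Proof.
elim: m g => [|m IH] g //=; under eq_bigr do rewrite IH.
exact: avg_cst.
Qed.

Lemma cube_avg_ge0 m f g : (forall g, 0 <= f g) -> 0 <= cube_avg m f g.
Proof. by move=> f0; rewrite -[leLHS](cube_avg_cst m _ g); exact: cube_avg_le. Qed.

Lemma cube_avgD m f1 f2 g :
  cube_avg m (fun g => f1 g + f2 g) g = cube_avg m f1 g + cube_avg m f2 g.
Proof.
elim: m g => [|m IH] g //=; under eq_bigr do rewrite IH.
by rewrite big_split mulrDr.
Qed.

Lemma cube_avgZ m c f g : cube_avg m (fun g => c * f g) g = c * cube_avg m f g.
Proof.
elim: m g => [|m IH] g //=; under eq_bigr do rewrite IH.
by rewrite -mulr_sumr mulrCA.
Qed.

Lemma cube_avg_shift m f t g :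
  cube_avg m (fun g => f (g + t)) g = cube_avg m f (g + t).
Proof.
by elim: m g => [|m IH] g //=; under eq_bigr do rewrite IH addrAC.
Qed.

Lemma cube_avg_invariant m f g y q : (y < m)%N ->
  cube_avg m f (g + h y q) = cube_avg m f g.
Proof.
elim: m g => [|m IH] g //=; rewrite ltnS leq_eqVlt => /orP[/eqP->|ym].
  congr (_ * _); rewrite [RHS](reindex_inj (addrI q)).
  by apply: eq_bigr => p _; rewrite raddfD/= addrA.
by congr (_ * _); apply: eq_bigr => p _; rewrite addrAC IH.
Qed.

Lemma cube_avg_invariant_sum m f (v : nat -> Q) g :
  cube_avg m f (g + \sum_(y < m) h y (v y)) = cube_avg m f g.
Proof.
suff H n : (n <= m)%N ->
    cube_avg m f (g + \sum_(y < n) h y (v y)) = cube_avg m f g by exact: H.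
elim: n => [|n IH] nm; first by rewrite big_ord0 addr0.
by rewrite big_ord_recr/= addrA cube_avg_invariant// IH// ltnW.
Qed.

(* Efron--Stein, by conditioning on one coordinate at a time. *)
Lemma cube_avg_variance m f (w : nat -> R) :
  (forall y g q, (y < m)%N -> `|f (g + h y q) - f g| <= w y) ->
  forall g, cube_avg m (fun g => f g ^+ 2) g - cube_avg m f g ^+ 2
              <= \sum_(y < m) w y ^+ 2.
Proof.
elim: m => [|m IH] lipf g /=; first by rewrite big_ord0 subrr.
have {}IH := IH (fun y g q ym => lipf y g q (ltnW ym)).
set E := fun q => cube_avg m f (g + h m q).
have lipE q : `|E q - E 0| <= w m.
  rewrite /E raddf0 addr0 -cube_avg_shift.
  have dif := fun g => lipf m g q (ltnSn m).
  rewrite ler_norml; apply/andP; split.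
    rewrite lerBrDr -[- w m](cube_avg_cst m _ g) -cube_avgD.
    by apply: cube_avg_le => g1; have := dif g1; rewrite ler_norml => /andP[+ _]; lra.
  rewrite lerBlDr -{1}[w m](cube_avg_cst m _ g) -cube_avgD.
  by apply: cube_avg_le => g1; have := dif g1; rewrite ler_norml => /andP[_ +]; lra.
set c := (#|Q|%:R)^-1.
have c0 : 0 < c by rewrite invr_gt0.
have avgle (a b : Q -> R) : (forall q, a q <= b q) -> c * \sum_q a q <= c * \sum_q b q.
  by move=> ab; rewrite ler_pM2l// ler_sum.
rewrite big_ord_recr/=; set W := \sum_(y < m) _.
have h1 : c * \sum_q cube_avg m (fun g => f g ^+ 2) (g + h m q) <=
          c * \sum_q (E q ^+ 2) + W.
  rewrite -{1}(avg_cst W) -mulrDr -big_split/=; apply: avgle => q.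
  by have := IH (g + h m q); rewrite /E -/W; lra.
have h2 : c * \sum_q (E q - E 0) ^+ 2 <= w m ^+ 2.
  rewrite -(avg_cst (w m ^+ 2)); apply: avgle => q.
  by rewrite -real_normK ?num_real// lerXn2r// ?nnegrE// (le_trans _ (lipE q)).
have h3 : c * \sum_q (E q - E 0) ^+ 2 =
          c * (\sum_q E q ^+ 2) - 2 * E 0 * (c * \sum_q E q) + E 0 ^+ 2.
  rewrite -{1}(avg_cst (E 0 ^+ 2)) !mulr_sumr -sumrB -big_split/=.
  by apply: eq_bigr => q _; rewrite -/c; ring.
(* The mean minimises the second moment, so the variance of [E] is at most its second moment about
   [E 0]. *)
have : 0 <= (c * (\sum_q E q) - E 0) ^+ 2 by rewrite sqr_ge0.
by move: h1 h2; rewrite h3; nra.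
Qed.

End CubeAverage.

Section HammingRecurrence.
Context (R : realFieldType) (Gam : zmodType) (Q : finZmodType).
Variable h : nat -> {additive Q -> Gam}.
Variables (m D : nat) (V : set Gam) (wt : Gam -> nat) (w : nat -> bool).
Variables (v : nat -> Q) (al : set Gam).
Hypotheses (V0 : V 0) (wt0 : wt 0 = 0%N).
Hypothesis V_shift : forall b y q, (y < m)%N -> V b -> V (b + h y q).
Hypothesis wt_shift : forall b y q, (y < m)%N -> (wt (b + h y q) <= wt b + w y)%N.
Let t := \sum_(y < m) h y (v y).
Hypothesis al_avoid : forall g b, al g -> V b -> (wt b < D)%N -> ~ al (g + t + b).

Let near d (g : Gam) := `[< exists b, [/\ V b, (wt b <= d)%N & al (g + b)] >].
(** Counting the radii [d < D] that fail to reach [al] gives the distance to [al] capped at [D]. *)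
Let dist (g : Gam) : R := \sum_(d < D) (~~ near d g)%:R.

Let near_shift d g y q : (y < m)%N -> near d g -> near (d + w y) (g + h y q).
Proof.
move=> ym /asboolP[b [Vb wb alb]]; apply/asboolP; exists (b + h y (- q)); split.
- exact: V_shift.
- by rewrite (leq_trans (wt_shift _ _ ym))// leq_add2r.
- by rewrite raddfN addrACA subrr addr0.
Qed.

Let dist_shift_le g y q : (y < m)%N -> dist (g + h y q) <= dist g + (w y)%:R.
Proof.
move=> ym; rewrite /dist; case: D => [|D']; first by rewrite !big_ord0 add0r ler0n.
have le_not (a b : bool) : (b -> a) -> ((~~ a)%:R : R) <= (~~ b)%:R.
  by case: a; case: b => //= ba; rewrite ?ler01//; case: (notF (ba _)).
case wy: (w y); last first.
  rewrite addr0; apply: ler_sum => d _; apply: le_not => nd.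
  by have := near_shift q ym nd; rewrite wy addn0.
(* Radius [d + 1] at the shifted point is compared with radius [d] at [g]; the unmatched radii [0]
   and [D'] cost at most [1]. *)
rewrite big_ord_recl/= [in leRHS]big_ord_recr/=.
have : \sum_(d < D') (~~ near (bump 0 d) (g + h y q))%:R
    <= \sum_(d < D') (~~ near d g)%:R :> R.
  by apply: ler_sum => d _; apply: le_not => /(near_shift q ym); rewrite wy addn1.
case: (~~ near 0 _); case: (~~ near D' _); rewrite /=; lra.
Qed.

(* The capped Hamming distance to [al] is [0] on [al] and [D] on a translate of [al],
   so both sets contribute to its variance. *)
Lemma hamming_density :
  cube_avg h m (fun g => (`[< al g >])%:R) 0 * D%:R ^+ 2
    <= 4 * \sum_(y < m) (w y)%:R :> R.
Proof.
have lip y g q : (y < m)%N -> `|dist (g + h y q) - dist g| <= (w y)%:R.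
  move=> ym; rewrite ler_norml; apply/andP; split.
    have := @dist_shift_le (g + h y q) y (- q) ym.
    by rewrite raddfN addrK; lra.
  by have := @dist_shift_le g y q ym; lra.
have := cube_avg_variance lip 0.
set W2 := \sum_(y < m) (w y)%:R.
rewrite (_ : \sum_(y < m) (w y)%:R ^+ 2 = W2); last first.
  by apply: eq_bigr => y _; case: (w y); rewrite ?expr1n ?expr0n.
set mu := cube_avg h m dist 0 => var.
set de := cube_avg h m _ 0.
have mom (c : R) : cube_avg h m (fun g => (dist g - c) ^+ 2) 0 <= W2 + (mu - c) ^+ 2.
  rewrite [X in cube_avg _ _ X](_ : _ =
      fun g => dist g ^+ 2 + ((- 2 * c) * dist g + c ^+ 2)); last first.
    by apply/funext => g; ring.
  by rewrite !cube_avgD cube_avgZ cube_avg_cst -/mu; move: var; nra.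
have al_dist g : al g -> dist g = 0.
  move=> alg; apply: big1 => d _; rewrite (_ : near d g)//.
  by apply/asboolP; exists 0; rewrite wt0 addr0.
have al_shift_dist g : al g -> dist (g + t) = D%:R.
  move=> alg; rewrite /dist (eq_bigr (fun=> 1)) ?sumr_const ?card_ord//.
  move=> d _; rewrite (_ : near _ _ = false)//; apply/negbTE/asboolP => -[b [Vb wb]].
  by apply: al_avoid => //; apply: leq_ltn_trans (ltn_ord d).
have h1 : mu ^+ 2 * de <= W2.
  have := mom mu; rewrite subrr expr0n addr0 -cube_avgZ; apply: le_trans.
  apply: cube_avg_le => g.
  case: asboolP => [/al_dist->|_]; first by rewrite mulr1 sub0r sqrrN.
  by rewrite mulr0 sqr_ge0.
have h2 : (D%:R - mu) ^+ 2 * de <= W2.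
  have := mom mu; rewrite subrr expr0n addr0 -cube_avgZ; apply: le_trans.
  rewrite -[leRHS](cube_avg_invariant_sum _ _ _ v) -cube_avg_shift.
  apply: cube_avg_le => g; rewrite -/t.
  case: asboolP => [/al_shift_dist->|_]; first by rewrite mulr1.
  by rewrite mulr0 sqr_ge0.
have de0 : 0 <= de.
  by apply: cube_avg_ge0 => g; exact: ler0n.
(* Twice [mu ^+ 2 + (D%:R - mu) ^+ 2] equals [D%:R ^+ 2 + (D%:R - 2 * mu) ^+ 2], so [h1] and [h2]
   add up to the bound with constant [4]. *)
have : 0 <= (D%:R - 2 * mu) ^+ 2 * de by rewrite mulr_ge0// sqr_ge0.
by nra.
Qed.

End HammingRecurrence.

End Concentration.

(** * A tree on the natural numbers *)

Section Tree.
Local Open Scope nat_scope.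

Definition ext_word (A : Type) (a0 : A) m (w : {ffun 'I_m -> A}) (u : nat) : A :=
  if insub u is Some o then w o else a0.

Lemma ext_wordE (A : Type) (a0 : A) m (w : {ffun 'I_m -> A}) u (um : u < m) :
  ext_word a0 w u = w (Ordinal um).
Proof. by rewrite /ext_word insubT. Qed.

Lemma ext_word_ord (A : Type) (a0 : A) m (w : {ffun 'I_m -> A}) (u : 'I_m) :
  ext_word a0 w u = w u.
Proof. by rewrite /ext_word valK. Qed.

Lemma ext_word_finfun (A : Type) (a0 : A) m (f : nat -> A) u : u < m ->
  ext_word a0 [ffun o : 'I_m => f o] u = f u.
Proof. by move=> um; rewrite ext_wordE ffunE. Qed.

(* A node of level [n] is a number [y < nnode n], whose digit of weight [nnode u] is
   less than [2 u + 3]; its ancestor of level [u <= n] is [y %% nnode u]. *)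
Fixpoint nnode n := if n is n'.+1 then nnode n' * (n'.*2 + 3) else 1.

Lemma nnode_gt0 n : 0 < nnode n.
Proof. by elim: n => //= n IH; lia. Qed.

Lemma nnodeS n : nnode n.+1 = nnode n * (n.*2 + 3).
Proof. by []. Qed.

Lemma nnode_gt n : n < nnode n.
Proof. by elim: n => //= n IH; nia. Qed.

Lemma dvdn_nnode m n : m <= n -> nnode m %| nnode n.
Proof.
elim: n => [|n IH]; first by rewrite leqn0 => /eqP->.
by rewrite leq_eqVlt => /orP[/eqP->//|/IH mn]; rewrite nnodeS dvdn_mulr.
Qed.

Lemma leq_nnode m n : m <= n -> nnode m <= nnode n.
Proof. by move=> mn; rewrite dvdn_leq ?nnode_gt0 ?dvdn_nnode. Qed.

Fact level_subproof y : exists l, y < nnode l.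
Proof. by exists y; exact: nnode_gt. Qed.

(** The digit [0] leads from a node to the same number one level deeper. Thus [level y] is the first
    level where [y] occurs, and every [y > 0] has a nonzero last digit there. *)
Definition level y := ex_minn (level_subproof y).

Lemma level_le y l : (level y <= l) = (y < nnode l).
Proof.
rewrite /level; case: ex_minnP => l0 yl0 min_l0; apply/idP/idP; last exact: min_l0.
by move=> /leq_nnode; exact: leq_trans.
Qed.

Lemma ltn_nnode_level y : y < nnode (level y).
Proof. by rewrite -level_le. Qed.

Lemma level_le_id y : level y <= y.
Proof. by rewrite level_le nnode_gt. Qed.

Lemma leq_level x y : x <= y -> level x <= level y.
Proof. by move=> xy; rewrite level_le (leq_ltn_trans xy) ?ltn_nnode_level. Qed.

Lemma level_gt0 y : 0 < y -> 0 < level y.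
Proof. by move=> y0; rewrite ltnNge level_le -ltnNge. Qed.

Definition parent y := y %% nnode (level y).-1.

Lemma parent_lt y : parent y < nnode (level y).-1.
Proof. by rewrite ltn_mod nnode_gt0. Qed.

Lemma leq_nnode_pred_level y : 0 < y -> nnode (level y).-1 <= y.
Proof. by move=> /level_gt0 y0; rewrite leqNgt -level_le; lia. Qed.

Lemma parent_ltn y : 0 < y -> parent y < y.
Proof. by move=> /leq_nnode_pred_level; apply: leq_trans; exact: parent_lt. Qed.

(* Whether node [j.+1] lies on the branch from the root to node [y]. *)
Definition hits y j : bool := y %% nnode (level j.+1) == j.+1.

(** The branch to [y] extends the branch to its parent by [y] alone. Stated in [nat], this becomes
    the additive recursion [ev_parent]. *)
Lemma hits_parent y j : 0 < y ->
  hits y j = ((hits (parent y) j : nat) + (j.+1 == y)) :> nat.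
Proof.
move=> y0; rewrite /hits.
have [ly|ly] := leqP (level j.+1) (level y).-1.
  rewrite modn_dvdm ?dvdn_nnode// (_ : (j.+1 == y) = false) ?addn0//.
  by apply/negbTE/eqP => jy; rewrite jy in ly; have := level_gt0 y0; lia.
have yj : level y <= level j.+1 by lia.
rewrite (@modn_small y) ?(leq_trans (ltn_nnode_level y) (leq_nnode yj))//.
rewrite (@modn_small (parent y)); last first.
  apply: leq_trans (parent_lt y) (leq_nnode _); lia.
rewrite [parent y == _](_ : _ = false) ?add0n 1?eq_sym//; apply/negbTE.
have : ~~ (j.+1 < nnode (level y).-1) by rewrite -level_le; have := level_gt0 y0; lia.
by have := parent_lt y; lia.
Qed.

(* Labels and random bits: below level [l0] the branch goes to the node [c], and
   its letter at a level [u >= l0] records the label [i] (once [i <= u]) and the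
   bit [w u]. *)
Definition letter i (w : nat -> bool) u := (minn i u).*2 + w u + 1.

Definition tail i w l0 l := \sum_(l0 <= u < l) nnode u * letter i w u.

Definition branch i w l0 c l := (c + tail i w l0 l) %% nnode l.

Definition branch_hits i w l0 c j := branch i w l0 c (level j.+1) == j.+1.

Lemma eq_branch_hits i w w' l0 c j : {in gtn j.+1, w =1 w'} ->
  branch_hits i w l0 c j = branch_hits i w' l0 c j.
Proof.
move=> ww; rewrite /branch_hits /branch /tail; congr ((_ + _) %% _ == _).
apply: eq_big_nat => u /andP[_ uj]; rewrite /letter ww// inE.
by rewrite (leq_trans uj) ?level_le_id.
Qed.

(** The digits at levels [u >= l] have weight [nnode u], a multiple of [nnode l]. *)
Lemma tail_mod i w l0 l l' : l <= l' -> tail i w l0 l' = tail i w l0 l %[mod nnode l].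
Proof.
rewrite /tail => ll'; have [l0l|ll0] := leqP l0 l.
  rewrite (big_cat_nat l0l ll')/=.
  rewrite -modnDmr (_ : (\sum_(l <= u < l') _) %% _ = 0) ?addn0//.
  apply/eqP; rewrite big_nat_cond; apply: dvdn_sum => u /andP[/andP[lu _] _].
  by rewrite dvdn_mulr ?dvdn_nnode.
rewrite (@big_geq _ _ _ l0 l) ?(ltnW ll0)// mod0n; apply/eqP; rewrite big_nat_cond.
apply: dvdn_sum => u /andP[/andP[l0u _] _].
by rewrite dvdn_mulr ?dvdn_nnode// ltnW// (leq_trans ll0).
Qed.

Lemma branch_hitsE i w l0 c j n : level j.+1 <= n ->
  branch_hits i w l0 c j = hits (c + tail i w l0 n) j.
Proof.
move=> jn; rewrite /branch_hits /branch /hits; congr (_ == _).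
by rewrite -modnDmr -(tail_mod _ _ _ jn) modnDmr.
Qed.

(** For [j <= t] the node [j.+1] is decided by level [level t.+1], where the random part only
    begins; so only the two starting nodes count. *)
Lemma branch_hits_parent i w t j : j <= t ->
  branch_hits i w (level t.+1) t.+1 j =
    (branch_hits i w (level t.+1) (parent t.+1) j : nat) + (j == t) :> nat.
Proof.
move=> jt; have ljt : level j.+1 <= level t.+1 by rewrite leq_level.
by rewrite !(branch_hitsE _ _ _ _ ljt) /tail big_geq// !addn0 hits_parent.
Qed.

(** A digit codes the pair of the label [j] and a bit. The added [1] keeps it nonzero; for [j <= k]
    it is at most [2 k + 2], below the base at every level from [k] on. *)
Definition zone_node k l j y0 (w : nat -> bool) :=
  y0 + \sum_(u < l) nnode (k + u) * (j.*2 + w u + 1).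

Lemma zone_node_lt k l j y0 w : j <= k -> y0 < nnode k ->
  zone_node k l j y0 w < nnode (k + l).
Proof.
move=> jk y0k; elim: l => [|l IH]; first by rewrite /zone_node big_ord0 !addn0.
rewrite addnS nnodeS /zone_node big_ord_recr/= addnA -/(zone_node k l j y0 w).
have : (w l : nat) <= 1 by case: (w l).
set z := zone_node _ _ _ _ _ in IH *; move: IH; set b := nnode _; nia.
Qed.

Lemma zone_node_gt0 k l j y0 w : 0 < l -> 0 < zone_node k l j y0 w.
Proof.
case: l => // l _; rewrite /zone_node big_ord_recl/= addn0.
by have := nnode_gt0 k; nia.
Qed.

(** Peel off the last digit: the remainder modulo its weight is the shorter node, the quotient
    determines label and bit. The label is visible because [0 < l]. *)
Lemma zone_node_inj k l j y0 w j' y0' w' : 0 < l ->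
  j <= k -> y0 < nnode k -> j' <= k -> y0' < nnode k ->
  zone_node k l j y0 w = zone_node k l j' y0' w' ->
  [/\ j = j', y0 = y0' & {in gtn l, w =1 w'}].
Proof.
move=> l0 jk yk jk' yk'.
have step n : zone_node k n.+1 j y0 w = zone_node k n.+1 j' y0' w' ->
    [/\ zone_node k n j y0 w = zone_node k n j' y0' w', j = j' & w n = w' n].
  rewrite /zone_node !big_ord_recr/= !addnA.
  have := zone_node_lt n w jk yk; have := zone_node_lt n w' jk' yk'.
  rewrite /zone_node; set z := (_ + \sum_(u < n) _); set z' := (_ + \sum_(u < n) _).
  set b := nnode _ => z'b zb e.
  have zz : z' = z.
    have := congr1 (modn^~ b) e.
    by rewrite ![b * _]mulnC ![_ + _ * b]addnC !modnMDl !modn_small.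
  have : j.*2 + w n = j'.*2 + w' n.
    move: e; rewrite zz => /addnI /eqP; rewrite eqn_pmul2l ?nnode_gt0//.
    by move=> /eqP; rewrite !addn1 => -[].
  by case: (w n) (w' n) => -[] e2; split => //; lia.
elim: l l0 => // l IH _ /step[e jj wl].
case: l IH e wl => [_ e wl|l IH e wl].
  split => //; first by move: e; rewrite /zone_node !big_ord0 !addn0.
  by move=> u; rewrite inE ltnS leqn0 => /eqP->.
have [//|_ yy ww] := IH _ e; split => // u.
by rewrite inE ltnS leq_eqVlt => /orP[/eqP->//|ul]; apply: ww.
Qed.

(** From level [i] on the cap in [letter] is inactive, so past level [k] a random branch stays in
    the zone of label [i] below its own ancestor. *)
Lemma branch_zone_node i w l0 c k l : l0 <= k -> i <= k ->
  c + tail i w l0 (k + l) = zone_node k l i (c + tail i w l0 k) (fun u => w (k + u)).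
Proof.
move=> l0k ik; rewrite /tail (big_cat_nat l0k) ?leq_addr//= addnA.
congr (_ + _); rewrite -{1}[k]add0n big_addn addKn big_mkord.
apply: eq_bigr => u _; rewrite addnC /letter (minn_idPl _)//.
exact: leq_trans (leq_addr _ _).
Qed.

Lemma branch_lt i w l0 c k : l0 <= k -> c < nnode l0 ->
  c + tail i w l0 k < nnode k.
Proof.
move=> l0k cl0; rewrite /tail -(subnKC l0k).
elim: (k - l0) => [|n IH]; first by rewrite addn0 big_geq ?addn0.
rewrite addnS nnodeS big_nat_recr ?leq_addr//= addnA.
have : letter i w (l0 + n) <= (l0 + n).*2 + 2.
  by rewrite /letter; have := geq_minr i (l0 + n); case: (w _) => /=; lia.
move: IH; set b := nnode _; set s := (_ + _); set m := letter _ _ _; nia.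
Qed.

End Tree.

(** * Values on the tree *)

Section TreeFunctions.
Local Open Scope ring_scope.

Section Coordinates.
(** An abstract form of [F] plus a countable direct sum of copies of [Q]: [co i] and [un i] are the
    projection to and inclusion of the copy [i], and [pF] is the projection to [F]. *)
Context (Gam Q F : zmodType).
Variables (co : nat -> {additive Gam -> Q}) (un : nat -> {additive Q -> Gam}).
Variable pF : {additive Gam -> F}.
Hypothesis co_un : forall i j v, co j (un i v) = v *+ (i == j).
Hypothesis pF_un : forall i v, pF (un i v) = 0.
Hypothesis co_inj : forall g, pF g = 0 -> (forall i, co i g = 0) -> g = 0.
Hypothesis co_fin : forall g, exists n, forall i, (n <= i)%N -> co i g = 0.

Definition supp_below n (g : Gam) := forall i, (n <= i)%N -> co i g = 0.

Definition supp_size g := projT1 (cid (co_fin g)).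

Lemma supp_sizeP g : supp_below (supp_size g) g.
Proof. exact: projT2 (cid (co_fin g)). Qed.

Lemma supp_below_le m n g : (m <= n)%N -> supp_below m g -> supp_below n g.
Proof. by move=> mn sm i ni; apply: sm; exact: leq_trans ni. Qed.

Lemma supp_belowD n g g' : supp_below n g -> supp_below n g' -> supp_below n (g + g').
Proof. by move=> sg sg' i ni; rewrite raddfD/= sg// sg'// addr0. Qed.

Lemma supp_belowN n g : supp_below n g -> supp_below n (- g).
Proof. by move=> sg i ni; rewrite raddfN/= sg// oppr0. Qed.

Definition subset_sum (c : nat -> bool) g : Q := \sum_(i < supp_size g) co i g *+ c i.

Lemma subset_sumE n c g : supp_below n g -> subset_sum c g = \sum_(i < n) co i g *+ c i.
Proof.
suff H m m' : (m <= m')%N -> supp_below m g ->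
    \sum_(i < m) co i g *+ c i = \sum_(i < m') co i g *+ c i.
  move=> sn; rewrite /subset_sum; have [|/ltnW] := leqP (supp_size g) n => le.
    by apply: H => //; exact: supp_sizeP.
  by apply/esym/H.
move=> mm' sm; rewrite -!(big_mkord xpredT (fun i => co i g *+ c i)).
rewrite [RHS](big_cat_nat (leq0n m) mm')/= [X in _ = _ + X]big_nat_cond.
by rewrite [X in _ = _ + X]big1 ?addr0// => i /andP[/andP[mi _] _]; rewrite sm// mul0rn.
Qed.

Fact subset_sum_is_zmod_morphism c : zmod_morphism (subset_sum c).
Proof.
move=> g g'; pose n := maxn (supp_size g) (supp_size g').
have sg : supp_below n g by apply: supp_below_le (@supp_sizeP g); rewrite leq_maxl.
have sg' : supp_below n g' by apply: supp_below_le (@supp_sizeP g'); rewrite leq_maxr.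
rewrite !(subset_sumE _ sg) !(subset_sumE _ sg') (@subset_sumE n); last first.
  by apply: supp_belowD => //; exact: supp_belowN.
by rewrite -sumrB; apply: eq_bigr => i _; rewrite raddfB/= mulrnBl.
Qed.

HB.instance Definition _ c :=
  GRing.isZmodMorphism.Build Gam Q (subset_sum c) (subset_sum_is_zmod_morphism c).

(* Under [co], [Gam] becomes the group of locally constant [Q]-valued functions on
   the boundary of the tree vanishing on the branch of the root; [ev y g] is the
   value of [g] at the node [y]. *)
Definition ev y : Gam -> Q := subset_sum (hits y).
HB.instance Definition _ y := GRing.Additive.on (ev y).

Lemma ev0 g : ev 0 g = 0.
Proof. by apply: big1 => i _; rewrite /hits mod0n mulr0n. Qed.

Lemma subset_sum_pred1 t g : subset_sum (fun j => j == t) g = co t g.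
Proof.
rewrite (subset_sumE _ (supp_below_le (leq_addr t.+1 _) (@supp_sizeP g))).
have tn : (t < supp_size g + t.+1)%N by rewrite addnS ltnS leq_addl.
rewrite (bigD1 (Ordinal tn))//= eqxx mulr1n big1 ?addr0// => i it.
by rewrite (_ : (i == t :> nat) = false) ?mulr0n//; exact/negbTE.
Qed.

Lemma subset_sum_add (c c1 c2 : nat -> bool) n g : supp_below n g ->
  (forall j, (j < n)%N -> c j = ((c1 j : nat) + c2 j)%N :> nat) ->
  subset_sum c g = subset_sum c1 g + subset_sum c2 g.
Proof.
move=> sn cE; rewrite !(subset_sumE _ sn) -big_split/=; apply: eq_bigr => i _.
by rewrite -mulrnDr cE.
Qed.

Lemma ev_parent t g : ev t.+1 g = ev (parent t.+1) g + co t g.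
Proof.
rewrite -subset_sum_pred1; apply: subset_sum_add (@supp_sizeP g) _ => j _.
by rewrite hits_parent// eqSS.
Qed.

Lemma ev_parentB t g : co t g = ev t.+1 g - ev (parent t.+1) g.
Proof. by rewrite ev_parent addrAC subrr add0r. Qed.

(** The inverse of [ev] at level [n]: the coordinate at a node is the increment from its parent.
    Coordinate [i] belongs to node [i.+1], the root having none, whence the [.-1]. *)
Definition of_values n (v : nat -> Q) : Gam :=
  \sum_(i < (nnode n).-1) un i (v i.+1 - v (parent i.+1)).

Definition at_level n (g : Gam) := pF g = 0 /\ supp_below (nnode n).-1 g.

Lemma at_levelD n g g' : at_level n g -> at_level n g' -> at_level n (g + g').
Proof.
move=> [p s] [p' s']; split; last exact: supp_belowD.
by rewrite raddfD/= p p' addr0.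
Qed.

Lemma at_levelN n g : at_level n g -> at_level n (- g).
Proof. by move=> [p s]; split; [rewrite raddfN/= p oppr0|exact: supp_belowN]. Qed.

Lemma at_level0 n : at_level n 0.
Proof. by split; [exact: raddf0|move=> i _; exact: raddf0]. Qed.

Lemma co_of_values n v j : (j < (nnode n).-1)%N ->
  co j (of_values n v) = v j.+1 - v (parent j.+1).
Proof.
move=> jn; rewrite raddf_sum/= (bigD1 (Ordinal jn))//= co_un eqxx mulr1n big1 ?addr0//.
by move=> i ij; rewrite co_un (_ : (i == j :> nat) = false) ?mulr0n//; exact/negbTE.
Qed.

Lemma of_values_at_level n v : at_level n (of_values n v).
Proof.
split; first by rewrite raddf_sum/= big1// => i _; exact: pF_un.
move=> j nj; rewrite raddf_sum/= big1// => i _; rewrite co_un.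
by rewrite (_ : (i == j :> nat) = false) ?mulr0n//; have := ltn_ord i; lia.
Qed.

Lemma ev_of_values n v y : v 0 = 0 -> (y < nnode n)%N -> ev y (of_values n v) = v y.
Proof.
move=> v0; elim/ltn_ind: y => -[|t] IH tn; first by rewrite ev0.
rewrite ev_parent IH ?parent_ltn// ?(ltn_trans (parent_ltn _) tn)//.
by rewrite co_of_values; [rewrite addrC subrK|lia].
Qed.

Lemma at_level_inj n g g' : at_level n g -> at_level n g' ->
  (forall y, (0 < y < nnode n)%N -> ev y g = ev y g') -> g = g'.
Proof.
move=> [pg sg] [pg' sg'] evgg'; apply/eqP; rewrite -subr_eq0; apply/eqP/co_inj.
  by rewrite raddfB/= pg pg' subrr.
move=> i; rewrite raddfB/=; apply/eqP; rewrite subr_eq0; apply/eqP.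
have [ni|ni] := leqP (nnode n).-1 i; first by rewrite sg// sg'.
rewrite !ev_parentB; congr (_ - _); first by apply: evgg'; lia.
have pi := @parent_ltn i.+1 isT.
by case: (parent i.+1) pi => [_|p pi]; [rewrite !ev0|apply: evgg'; lia].
Qed.

(** Changes the value at the single node [y.+1] of level [n], whereas [un y] changes a whole
    subtree. These are the coordinate directions of the Hamming cube. *)
Definition direction n y (q : Q) : Gam := of_values n (fun y' => q *+ (y' == y.+1)).

Fact direction_is_zmod_morphism n y : zmod_morphism (direction n y).
Proof.
move=> q q'; rewrite /direction /of_values -sumrB; apply: eq_bigr => i _.
rewrite -raddfB/=; congr (un _ _).
by rewrite !mulrnBl !opprB addrACA [RHS]addrACA; congr (_ + _); rewrite addrC.
Qed.

HB.instance Definition _ n y := GRing.isZmodMorphism.Build Q Gam (direction n y)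
  (direction_is_zmod_morphism n y).

Lemma ev_direction n y q z : (z < nnode n)%N ->
  ev z (direction n y q) = q *+ (z == y.+1).
Proof. by move=> zn; rewrite ev_of_values// mulr0n. Qed.

Lemma of_values_directions n v : v 0 = 0 ->
  of_values n v = \sum_(y < (nnode n).-1) direction n y (v y.+1).
Proof.
move=> v0; apply: (@at_level_inj n); first exact: of_values_at_level.
  elim/big_ind: _ => [||y _]; [exact: at_level0|exact: at_levelD|].
  exact: of_values_at_level.
move=> z /andP[z0 zn]; rewrite ev_of_values// raddf_sum/=.
have zn' : (z.-1 < (nnode n).-1)%N by lia.
rewrite (bigD1 (Ordinal zn'))//= ev_direction// prednK// eqxx mulr1n.
rewrite big1 ?addr0// => y yz; rewrite ev_direction//.
rewrite (_ : (z == y.+1) = false) ?mulr0n//; apply/negbTE; apply: contraNneq yz => zy.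
by apply/eqP/val_inj; rewrite /= zy.
Qed.

Lemma at_level_of_values n g : at_level n g -> g = of_values n (fun y => ev y g).
Proof.
move=> gn; apply: (at_level_inj gn); first exact: of_values_at_level.
by move=> y /andP[_ yn]; rewrite ev_of_values// ev0.
Qed.

(* Difference of [g] along two random branches, through the node [t.+1] and through its
   parent. It is triangular in [t] ([random_coord_top]), which makes the action built
   from it free, and it vanishes with high probability if [g] is mostly [0]. *)
Definition random_coord i t (w : nat -> bool) (g : Gam) : Q :=
  subset_sum (branch_hits i w (level t.+1) t.+1) g
  - subset_sum (branch_hits i w (level t.+1) (parent t.+1)) g.

Lemma random_coordD i t w g g' :
  random_coord i t w (g + g') = random_coord i t w g + random_coord i t w g'.
Proof. by rewrite /random_coord !raddfD/= addrACA. Qed.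

Lemma random_coord_top i t w g : supp_below t.+1 g -> random_coord i t w g = co t g.
Proof.
move=> st; rewrite /random_coord -subset_sum_pred1 (@subset_sum_add _
  (branch_hits i w (level t.+1) (parent t.+1)) (fun j => j == t) _ _ st); last first.
  by move=> j jt; exact: branch_hits_parent.
by rewrite addrAC subrr add0r.
Qed.

Lemma random_coord0 i t w g : supp_below t g -> random_coord i t w g = 0.
Proof.
by move=> st; rewrite random_coord_top ?st//; exact: supp_below_le st.
Qed.

(** Node [j.+1] is tested on at most [j.+1] digits, so bits beyond the support of [g] have no
    influence. *)
Lemma eq_random_coord i t w w' g : {in gtn (supp_size g), w =1 w'} ->
  random_coord i t w g = random_coord i t w' g.
Proof.
move=> ww; congr (_ - _); apply: eq_bigr => j _; congr (_ *+ nat_of_bool _);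
  apply: eq_branch_hits => u; rewrite inE ltnS => uj; apply: ww;
  by rewrite inE (leq_ltn_trans uj).
Qed.

Lemma random_coord_level i t w g n : at_level n g ->
  random_coord i t w g = ev (t.+1 + tail i w (level t.+1) n) g
    - ev (parent t.+1 + tail i w (level t.+1) n) g.
Proof.
move=> [_ sg]; congr (_ - _); rewrite /ev !(subset_sumE _ sg);
  apply: eq_bigr => j _; rewrite (@branch_hitsE _ _ _ _ _ n)// level_le;
  by have := ltn_ord j; lia.
Qed.

Lemma exists_top_coord g : pF g = 0 -> g != 0 ->
  exists2 t, supp_below t.+1 g & co t g != 0.
Proof.
move=> pg g0; have ex : exists n, `[< supp_below n g >].
  by exists (supp_size g); apply/asboolP; exact: supp_sizeP.
have [n /asboolP sn minn] := ex_minnP ex.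
case: n sn minn => [s0 _|t st mint].
  by case/eqP: g0; apply: co_inj => // i; exact: s0.
exists t => //; apply/negP => /eqP ct; have := mint t; rewrite ltnn => H.
apply: notF; apply: H; apply/asboolP => i; rewrite leq_eqVlt => /orP[/eqP<-//|].
exact: st.
Qed.

End Coordinates.

End TreeFunctions.

(** * Recurrence *)

Section Stages.
Local Open Scope ring_scope.

Section Stage.
Context (R : realFieldType) (Gam : zmodType) (Q : finZmodType) (F : zmodType).
Variables (co : nat -> {additive Gam -> Q}) (un : nat -> {additive Q -> Gam}).
Variable pF : {additive Gam -> F}.
Hypothesis co_un : forall i j v, co j (un i v) = v *+ (i == j).
Hypothesis pF_un : forall i v, pF (un i v) = 0.
Hypothesis co_inj : forall g, pF g = 0 -> (forall i, co i g = 0) -> g = 0.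
Hypothesis co_fin : forall g, exists n, forall i, (n <= i)%N -> co i g = 0.
Variable q1 : Q.
Hypothesis q1_neq0 : q1 != 0.
Variable s : nat -> Gam.
Local Notation ev := (ev co_fin).

Definition zone_value k l j y0 (w : {ffun 'I_l -> bool}) : Gam -> Q :=
  ev (zone_node k l j y0 (ext_word false w)).
HB.instance Definition _ k l j y0 w := GRing.Additive.on (@zone_value k l j y0 w).

(* Below each node [y0] of level [k] there are [2 ^ l] nodes of level [k + l] whose last
   [l] labels are [j]. An element of the stage agrees with [s j] at most of them, for
   all [j < k]; the label [k] is left free in order to have [stage_translate]. *)
Definition stage k l (a : Gam) : Prop := at_level co pF (k + l) a /\
  forall j y0, (j < k)%N -> (y0 < nnode k)%N ->
    (#|[set w : {ffun 'I_l -> bool} | zone_value k j y0 w a != zone_value k j y0 w (s j)]|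
      <= 2 ^ l %/ k.+1)%N.

Variables (k l : nat).
Hypothesis l_gt0 : (0 < l)%N.
Local Notation n := (k + l)%N.
Local Notation zone := ('I_k.+1 * 'I_(nnode k) * {ffun 'I_l -> bool})%type.

Let node (p : zone) : nat := zone_node k l p.1.1 p.1.2 (ext_word false p.2).

Let node_lt p : (node p < nnode n)%N.
Proof. by apply: zone_node_lt; rewrite ?ltn_ord// -ltnS ltn_ord. Qed.

Let node_gt0 p : (0 < node p)%N. Proof. exact: zone_node_gt0. Qed.

Let node_inj : injective node.
Proof.
move=> [[j y0] w] [[j' y0'] w'] /zone_node_inj[] //=; rewrite -1?ltnS ?ltn_ord//.
move=> /val_inj-> /val_inj-> ww; congr (_, _); apply/ffunP => u.
by rewrite -(ext_word_ord false) ww ?inE ?ltn_ord// ext_word_ord.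
Qed.

(** Only zone nodes count, those of label [k] included. Changing the value elsewhere costs nothing,
    so [hit] can be [0]. *)
Let weight b := #|[set p : zone | ev (node p) b != 0]|.
Let hit y := [exists p, node p == y.+1].

Let weight_direction b y q : (weight (b + direction un n y q) <= weight b + hit y)%N.
Proof.
have dirE p : ev (node p) (direction un n y q) = q *+ (node p == y.+1).
  by apply: ev_direction.
have sub (A B : {set zone}) : (forall p, p \in A -> p \in B) -> (#|A| <= #|B|)%N.
  by move=> AB; apply/subset_leq_card/fintype.subsetP.
rewrite /hit; case: existsP => [[p /eqP py]|nop]; last first.
  rewrite addn0; apply: sub => p; rewrite !inE raddfD/= dirE.
  case: (node p =P y.+1) => [py|_]; last by rewrite mulr0n addr0.
  by case: nop; exists p; exact/eqP.
rewrite -[nat_of_bool true](cards1 p); apply: leq_trans (leq_card_setU _ _).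
apply: sub => p'; rewrite !inE raddfD/= dirE -py.
case: (node p' =P node p) => [/node_inj->|_].
  by rewrite eqxx orbT.
by rewrite mulr0n addr0 => ->.
Qed.

Let sum_hit : (\sum_(y < (nnode n).-1) hit y <= #|{: zone}|)%N.
Proof.
rewrite -sum1_card.
have -> : (\sum_(p : zone) 1 =
    \sum_(p : zone) \sum_(y < (nnode n).-1) (node p == y.+1))%N.
  apply: eq_bigr => p _; have pn := node_lt p; have p0 := node_gt0 p.
  have pn' : ((node p).-1 < (nnode n).-1)%N by lia.
  rewrite (bigD1 (Ordinal pn'))//= prednK// eqxx big1 ?addn0// => y yp.
  case: eqP => // e; case/eqP: yp; apply/val_inj; by rewrite /= e.
rewrite exchange_big/=; apply: leq_sum => y _; rewrite /hit.
case: existsP => [[p py]|//]; by rewrite (bigD1 p)//= py.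
Qed.

(* The lower bound on the weight keeps [t + b] away from [0] for [b] of small weight. *)
Lemma stage_translate i : (i < k)%N -> exists t, [/\ at_level co pF n t,
   (forall j y0 w, (j < k)%N -> (y0 < nnode k)%N ->
     @zone_value k l j y0 w t = zone_value k j y0 w (s j - s i)) &
   (2 ^ l <= weight t)%N].
Proof.
move=> ik.
(* The values [s j - s i] on the zones of label [j < k] make [t + s i] agree with each [s j] there;
   the nonzero [q1] on label [k] gives the weight; all other nodes get [0]. *)
pose v y := if [pick p | node p == y] is Some p then
  (if (p.1.1 < k)%N then ev y (s p.1.1 - s i) else q1) else 0.
have vE p : v (node p) = if (p.1.1 < k)%N then ev (node p) (s p.1.1 - s i) else q1.
  rewrite /v; case: pickP => [p' /eqP/node_inj->//|/(_ p)]; by rewrite eqxx.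
have v0 : v 0%N = 0.
  by rewrite /v; case: pickP => // p /eqP p0; have := node_gt0 p; rewrite p0.
exists (of_values un n v); split; first exact: of_values_at_level.
  move=> j y0 w jk y0k; have jk1 : (j < k.+1)%N by rewrite ltnW.
  have := vE (Ordinal jk1, Ordinal y0k, w).
  rewrite /= jk /zone_value /node /= => <-; apply: ev_of_values => //.
  exact: node_lt (Ordinal jk1, Ordinal y0k, w).
have k0 : (0 < nnode k)%N by exact: nnode_gt0.
(* The nodes of label [k] below the root [y0 = 0] already provide the weight [2 ^ l]. *)
pose f (w : {ffun 'I_l -> bool}) : zone := (ord_max, Ordinal k0, w).
rewrite (_ : (2 ^ l)%N = #|[set f w | w : {ffun 'I_l -> bool}]|).
  apply/subset_leq_card/fintype.subsetP => p /imsetP[w _ ->]; rewrite inE.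
  by rewrite ev_of_values// vE /= ltnn.
by rewrite card_imset ?card_ffun ?card_bool ?card_ord// => w w' [].
Qed.

Hypothesis k_le_l : (4 * k.+1 ^ 4 * nnode k <= 2 ^ l)%N.
Hypothesis s_level : forall j, (j < k)%N -> at_level co pF n (s j).

Let radius := (2 ^ l %/ k.+1)%N.

(** Since [t + s i] agrees with [s j] on the whole zone of label [j], adding [b] spoils at most
    [weight b] nodes. *)
Let stage_translate_ball i t b : (i < k)%N -> at_level co pF n t ->
  (forall j y0 w, (j < k)%N -> (y0 < nnode k)%N ->
     @zone_value k l j y0 w t = zone_value k j y0 w (s j - s i)) ->
  at_level co pF n b -> (weight b <= radius)%N -> stage k l (t + b + s i).
Proof.
move=> ik tn tz bn wb; split.
  by apply: at_levelD; [exact: at_levelD|exact: s_level].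
move=> j y0 jk y0k; apply: leq_trans wb; have jk1 : (j < k.+1)%N by rewrite ltnW.
pose f (w : {ffun 'I_l -> bool}) : zone := (Ordinal jk1, Ordinal y0k, w).
rewrite -(@card_imset _ _ f) => [|w w' []//].
apply/subset_leq_card/fintype.subsetP => p /imsetP[w + ->]; rewrite !inE.
apply: contraNN => /eqP b0; rewrite !raddfD/= tz// raddfB/=.
by rewrite [zone_value k j y0 w b]b0 addr0 subrK.
Qed.

Lemma stage_nonempty : (0 < k)%N -> exists a, stage k l a.
Proof.
move=> k0; have [t [tn tz _]] := stage_translate k0; exists (t + 0 + s 0).
apply: stage_translate_ball => //; first exact: at_level0.
by rewrite /weight (eq_card0 (A := _)) // => p; rewrite !inE raddf0 eqxx.
Qed.

(** For [weight b <= radius] the element [t + b] is a nonzero difference [a - s i] with [a] in the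
    stage, so [al] misses its translate by [t + b]. This is the situation of [hamming_density] with
    [D = radius.+1]. *)
Lemma stage_density i (al : set Gam) : (i < k)%N ->
  (forall g a, stage k l a -> a != s i -> al g -> ~ al (g + (a - s i))) ->
  cube_avg (direction un n) (nnode n).-1 (fun g => (`[< al g >])%:R) 0 <= k.+1%:R^-1 :> R.
Proof.
move=> ik avoid; have [t [tn tz wt]] := stage_translate ik.
have k0 : (0 < k)%N by exact: leq_ltn_trans ik.
have lt_rad : (radius < 2 ^ l)%N by apply: ltn_Pdiv; rewrite ?expn_gt0.
have tE : t = \sum_(y < (nnode n).-1) direction un n y (ev y.+1 t).
  transitivity (of_values un n (fun y => ev y t)).
    by apply: at_level_of_values tn.
  by apply: (of_values_directions co_un pF_un co_inj co_fin); exact: ev0.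
have dens := @hamming_density R Gam Q (direction un n) (nnode n).-1 radius.+1
  [set g | at_level co pF n g]%classic weight hit (fun y => ev y.+1 t) al.
have {}dens : cube_avg (direction un n) (nnode n).-1 (fun g => (`[< al g >])%:R) 0
    * radius.+1%:R ^+ 2 <= 4 * #|{: zone}|%:R :> R.
  apply: le_trans (dens _ _ _ _ _) _.
  - exact: at_level0.
  - by apply/eqP; rewrite cards_eq0; apply/eqP/setP => p; rewrite !inE raddf0 eqxx.
  - by move=> b y q _ bn; apply: at_levelD => //; exact: of_values_at_level.
  - by move=> b y q _; exact: weight_direction.
  - move=> g b alg bn; rewrite ltnS => wb.
    suff : ~ al (g + (t + b)) by rewrite addrA {1}tE.
    have -> : t + b = (t + b + s i) - s i by rewrite addrK.
    apply: avoid => //; first exact: stage_translate_ball.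
    rewrite -subr_eq0 addrK; apply: contraTneq wb => tb0.
    rewrite -ltnNge (leq_trans lt_rad)// (leq_trans wt)//.
    apply/subset_leq_card/fintype.subsetP => p; rewrite !inE.
    move/eqP: tb0; rewrite addr_eq0 => /eqP->; rewrite raddfN/= oppr_eq0.
    by [].
  by rewrite ler_pM2l// -natr_sum ler_nat sum_hit.
set de := cube_avg _ _ _ _ in dens *.
have cardZ : #|{: zone}| = (k.+1 * nnode k * 2 ^ l)%N.
  by rewrite !card_prod !card_ord card_ffun card_bool card_ord.
have rk : (2 ^ l < radius.+1 * k.+1)%N by rewrite ltn_ceil.
(* Multiplied by [k.+1 ^ 2], this is [k_le_l] times [2 ^ l]. *)
have num : (4 * #|{: zone}| * k.+1 <= radius.+1 ^ 2)%N.
  rewrite cardZ -(leq_pmul2r (_ : 0 < k.+1 ^ 2)%N) ?expn_gt0//.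
  rewrite -expnMn (@leq_trans ((2 ^ l) ^ 2)%N) ?leq_exp2r// ?(ltnW rk)//.
  move: k_le_l; set L := (2 ^ l)%N; set N := nnode k; set K := k.+1.
  move=> /(leq_mul (leqnn L)); rewrite mulnn; apply: leq_trans.
  by rewrite !expnS expn0; lia.
rewrite -(ler_pM2r (_ : 0 < radius.+1%:R ^+ 2)) ?exprn_gt0 ?ltr0n//.
apply: le_trans dens _; rewrite ler_pdivlMl ?ltr0n// -natrX.
by rewrite -!natrM ler_nat mulnC.
Qed.

End Stage.

End Stages.

(** * Recurrence from density bounds on finite cubes *)

Section RecurrenceCriterion.
Local Open Scope classical_set_scope.
Local Open Scope ring_scope.

Section Recurrence.
Context (R : realType) (Gam : zmodType) (Q : finZmodType).

(** Each averaged term is the indicator of a preimage of [A] under some [act g], hence has the same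
    integral as the indicator of [A]. *)
Lemma integral_cube_avg (S : system R Gam) (h : nat -> {additive Q -> Gam}) m
    (A : set (sys_space S)) g : measurable A ->
  let F x : R := cube_avg h m (fun g => (`[< A (act g x) >])%:R) g in
  measurable_fun setT F /\ (\int[prob S]_x (F x)%:E = prob S A)%E.
Proof.
move=> mA; elim: m g => [|m IH] g /=.
  have mgA : measurable (act g @^-1` A).
    by rewrite -[_ @^-1` _]setTI; exact: act_measurable.
  rewrite (_ : (fun x => _) = \1_(act g @^-1` A)); last first.
    by apply/funext => x; rewrite indicE; congr (nat_of_bool _)%:R.
  split; first exact: measurable_indic.
  by rewrite integral_indic// setIT; exact: act_preserving.
have mF : measurable_fun setT (fun x : sys_space S =>
    \sum_q cube_avg h m (fun g0 => (`[< A (act g0 x) >])%:R : R) (g + h m q)).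
  by apply: measurable_sum => q; have [] := IH (g + h m q).
split; first exact: measurable_funM.
have F0 q x : 0 <= cube_avg h m (fun g0 => (`[< A (act g0 x) >])%:R : R) (g + h m q).
  by apply: cube_avg_ge0 => ?; exact: ler0n.
have cQ : 0 < (#|Q|%:R : R) by rewrite ltr0n; apply/card_gt0P; exists 0.
under eq_integral do rewrite EFinM.
rewrite ge0_integralZl_EFin//; last 2 first.
- by move=> x _; rewrite lee_fin sumr_ge0.
- exact/measurable_EFinP.
under eq_integral do rewrite -sumEFin.
rewrite ge0_integral_sum//; last 2 first.
- by move=> q; apply/measurable_EFinP; have [] := IH (g + h m q).
- by move=> q x _; rewrite lee_fin.
under eq_bigr do rewrite (IH _).2.
have /fineK <- : prob S A \is a fin_num by exact: fin_num_measure.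
by rewrite sumEFin -EFinM sumr_const -(mulr_natl (fine _)) mulrA mulVf ?mul1r// gt_eqF.
Qed.

(** Transference: without recurrence, for each [x] the set of [g] with [act g x] in [A'] has no two
    elements differing by a nonzero [a n], so its density is at most [e]. Integrating over [x]
    bounds the measure of [A]. *)
Lemma set_of_recurrence_criterion (a : nat -> Gam) :
  (forall e : R, 0 < e -> exists (h : nat -> {additive Q -> Gam}) m,
     forall al : set Gam,
       (forall g n, a n != 0 -> al g -> ~ al (g + a n)) ->
       cube_avg h m (fun g => (`[< al g >])%:R) 0 <= e) ->
  set_of_recurrence R (range a).
Proof.
move=> dens S A mA A0; apply: contrapT => norec.
have null r : range a r -> r != 0 -> prob S (A `&` act r @^-1` A) = 0%E.
  move=> ar r0; apply/eqP; rewrite eq_le measure_ge0 andbT leNgt; apply/negP => pos.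
  by apply: norec; exists r.
pose B n := if a n == 0 then set0 else A `&` act (a n) @^-1` A.
have mB n : measurable (B n).
  rewrite /B; case: ifP => // _; apply: measurableI => //.
  by rewrite -[_ @^-1` _]setTI; exact: act_measurable.
have mUB : measurable (\bigcup_n B n) by exact: bigcup_measurable.
have UB0 : prob S (\bigcup_n B n) = 0%E.
  apply/eqP; rewrite eq_le measure_ge0 andbT.
  apply: le_trans (measure_sigma_subadditive (prob S) mB mUB (@subset_refl _ _)) _.
  rewrite eseries0// => n _ _; rewrite /B; case: ifPn => [_|an]; first exact: measure0.
  by apply: null => //; exists n.
(* [A'] has the measure of [A], and no return at all along [range a]. *)
pose A' := A `\` \bigcup_n B n.
have mA' : measurable A' by exact: measurableD.
have PA' : prob S A' = prob S A.
  have AB0 : prob S (A `&` \bigcup_n B n) = 0%E.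
    apply/eqP; rewrite eq_le measure_ge0 andbT -UB0 le_measure ?inE//.
    by apply: measurableI.
  transitivity (prob S A - prob S (A `&` \bigcup_n B n))%E.
    by apply: measureD => //; rewrite ltey_eq fin_num_measure.
  by rewrite AB0 sube0.
have PAfin : prob S A \is a fin_num by exact: fin_num_measure.
have p0 : 0 < fine (prob S A) / 2 by rewrite divr_gt0// fine_gt0// A0 ltey_eq PAfin.
have [h [m H]] := dens _ p0.
have [mF intF] := integral_cube_avg h m 0 mA'.
have : (prob S A <= (fine (prob S A) / 2)%:E)%E.
  rewrite -[leLHS]PA' -intF.
  apply: (@le_trans _ _ (\int[prob S]_x (fine (prob S A) / 2)%:E)%E).
    apply: ge0_le_integral => //.
    - by move=> x _; rewrite lee_fin; apply: cube_avg_ge0 => ?; exact: ler0n.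
    - exact/measurable_EFinP.
    move=> x _; rewrite lee_fin; apply: (H [set g | A' (act g x)]) => g n an /=.
    move=> [Ax nB] [Ay _]; apply: nB; exists n => //; rewrite /B (negbTE an).
    by split => //=; rewrite -actD addrC.
  rewrite integral_cst// -[leRHS]mule1; apply: lee_wpmul2l.
    by rewrite lee_fin ltW.
  by rewrite le_eqVlt; apply/orP; left; apply/eqP; exact: probability_setT.
by rewrite -{1}(fineK PAfin) lee_fin; move: p0 => /=; lra.
Qed.

End Recurrence.

End RecurrenceCriterion.

(** * The unit interval as a Lebesgue space *)

Section UnitInterval.
Local Open Scope classical_set_scope.
Local Open Scope ring_scope.

Section LebesgueOuter.
Context (R : realType).
Local Open Scope ereal_scope.

Definition lebesgue_outer (A : set R) : \bar R := (@wlength R idfun)^*%mu A.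
HB.instance Definition _ := OuterMeasure.copy lebesgue_outer (@wlength R idfun)^*%mu.

Lemma preimage_shift_itv (c a b : R) :
  (fun x => x + c)%R @^-1` `]a, b]%classic = `](a - c)%R, (b - c)%R]%classic.
Proof.
by apply/seteqP; split => x /=; rewrite !in_itv/= => /andP[? ?]; apply/andP; split; lra.
Qed.

Lemma lebesgue_outer_shift (c : R) (A : set R) :
  lebesgue_outer ((fun x => x + c)%R @^-1` A) <= lebesgue_outer A.
Proof.
apply: le_ereal_inf_tmp => _ [F [mF AF] <-].
apply: ereal_inf_lbound; exists (fun k => (fun x => x + c)%R @^-1` F k).
  split=> [k|x /AF[k _ Fk]]; last by exists k.
  by have [[a b] _ <-] := mF k; rewrite preimage_shift_itv; exact: is_ocitv.
apply: eq_eseriesr => k _; have [[a b] _ /= <-] := mF k.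
rewrite preimage_shift_itv !wlength_itv/= !lte_fin ltrD2r; case: ifP => // _.
by rewrite -!EFinD; congr EFin; lra.
Qed.

Lemma lebesgue_outer_itv (a b : R) (x y : bool) : (a <= b)%R ->
  lebesgue_outer [set` Interval (BSide x a) (BSide y b)] = (b - a)%:E.
Proof.
move=> ab.
have -> : lebesgue_outer [set` Interval (BSide x a) (BSide y b)] =
    lebesgue_measure [set` Interval (BSide x a) (BSide y b)] by [].
rewrite lebesgue_measure_itv/= lte_fin; case: ltP => // ba.
by rewrite (_ : a = b) ?subrr//; apply/eqP; rewrite eq_le ab.
Qed.

Lemma caratheodory_itv (i : interval R) : lebesgue_outer.-caratheodory [set` i].
Proof.
exact: (@sub_caratheodory _ _ _ (@wlength R idfun) [set` i] (measurable_itv i)).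
Qed.

(* Lebesgue measure on [0, 1[ carried by the whole line. Taking its own Caratheodory
   sigma-algebra makes it complete: every set of reals outside [0, 1[ is measurable. *)
Definition unit_outer (A : set R) : \bar R := lebesgue_outer (A `&` `[0%R, 1%R[%classic).

Fact unit_outer0 : unit_outer set0 = 0.
Proof. by rewrite /unit_outer set0I outer_measure0. Qed.

Fact unit_outer_ge0 A : 0 <= unit_outer A.
Proof. exact: outer_measure_ge0. Qed.

Fact le_unit_outer : {homo unit_outer : A B / A `<=` B >-> A <= B}.
Proof. by move=> A B AB; apply: le_outer_measure; exact: setSI. Qed.

Fact unit_outer_sigma_subadditive : sigma_subadditive unit_outer.
Proof.
by move=> F; rewrite /unit_outer setI_bigcupl; exact: outer_measure_sigma_subadditive.
Qed.

HB.instance Definition _ := isOuterMeasure.Build R R unit_outer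
  unit_outer0 unit_outer_ge0 le_unit_outer unit_outer_sigma_subadditive.

Definition unit_space : measurableType _ := caratheodory_type unit_outer.

Definition unit_prob : set unit_space -> \bar R := unit_outer.

Fact unit_prob_semi_sigma_additive : semi_sigma_additive unit_prob.
Proof. by move=> F mF tF mUF; exact: caratheodory_measure_sigma_additive. Qed.

HB.instance Definition _ := isMeasure.Build _ _ _ unit_prob
  unit_outer0 unit_outer_ge0 unit_prob_semi_sigma_additive.

Fact unit_probT : unit_prob setT = 1.
Proof. by rewrite /unit_prob /unit_outer setTI lebesgue_outer_itv// subr0. Qed.

HB.instance Definition _ := Measure_isProbability.Build _ _ _ unit_prob unit_probT.

Lemma caratheodory_unit_outer (A : set R) : lebesgue_outer.-caratheodory A ->
  unit_outer.-caratheodory A.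
Proof. by move=> mA X; rewrite /unit_outer (setIAC X A) (setIAC X (~` A)); exact: mA. Qed.

(** Split a test set by [[0, 1[]: inside, the hypothesis applies; outside, [A] has no points. *)
Lemma unit_outer_caratheodory (A : set R) : A `<=` `[0%R, 1%R[%classic ->
  unit_outer.-caratheodory A -> lebesgue_outer.-caratheodory A.
Proof.
move=> A01 mA; have -> : A = `[0%R, 1%R[%classic `&` A.
  by apply/esym/setIidPr.
move=> X; rewrite (caratheodory_itv `[0%R, 1%R[ X).
have := mA X; rewrite /unit_outer => ->.
rewrite -(setIA X A) (setIC A) (setIAC X) -addeA; congr (_ + _).
rewrite (caratheodory_itv `[0%R, 1%R[ (X `&` ~` (_ `&` A))); congr (_ + _).
  congr lebesgue_outer; apply/seteqP; split => x /=; tauto.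
congr lebesgue_outer; apply/seteqP; split => x /=; tauto.
Qed.

Lemma unit_space_lebesgue : nonatomic_lebesgue_space unit_prob.
Proof.
split; first exact: measure_is_complete_caratheodory.
have m01 : unit_outer.-caratheodory (`[0%R, 1%R[%classic : set R).
  exact/caratheodory_unit_outer/caratheodory_itv.
have P01 : unit_outer (`[0%R, 1%R[%classic : set R) = 1.
  by rewrite /unit_outer setIid lebesgue_outer_itv// subr0.
exists (`[0%R, 1%R[%classic : set R), (`[0%R, 1%R[%classic : set R), id.
split.
- by split; [exact: m01|exact: P01].
- split; first exact: caratheodory_itv.
    by move=> x /=; rewrite !in_itv/= => /andP[-> /ltW].
  have := @lebesgue_outer_itv 0%R 1%R true true ler01; rewrite subr0 => e.
  exact: e.
- by split => // x; exists x.
- move=> A A01; rewrite image_id; split; first exact: unit_outer_caratheodory.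
  exact: caratheodory_unit_outer.
- move=> A A01 mA; rewrite image_id; have /setIidPl A01E := A01.
  change (lebesgue_outer (A `&` `[0%R, 1%R[%classic) = lebesgue_outer A).
  by rewrite A01E.
Qed.

End LebesgueOuter.

End UnitInterval.

(** * Actions on digit sequences *)

Section DigitExpansions.
Local Open Scope classical_set_scope.
Local Open Scope ring_scope.

Section Digits.
Context (R : realType) (D : finType) (d0 : D).
Hypothesis D_gt1 : (1 < #|D|)%N.
Local Notation b := #|D|.
Implicit Types (x : R) (w : nat -> D).

(** For [x] in [[0, 1[], the number written by the first [n] digits of [x] in base [b]. *)
Definition prefix_nat x n : nat := Num.truncn (b%:R ^+ n * x).

Definition digit x t : D := nth d0 (enum D) (prefix_nat x t.+1 %% b).

Fixpoint word_val w n : nat :=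
  if n is n'.+1 then (word_val w n' * b + enum_rank (w n'))%N else 0%N.

Let b_gt0 : (0 < b)%N. Proof. exact: ltn_trans D_gt1. Qed.

Let bX_gt0 n : 0 < b%:R ^+ n :> R. Proof. by rewrite exprn_gt0// ltr0n. Qed.

Let rank_nth a : (a < b)%N -> enum_rank (nth d0 (enum D) a) = a :> nat.
Proof.
move=> ab; have -> : nth d0 (enum D) a = enum_val (Ordinal ab).
  by rewrite (enum_val_nth d0).
by rewrite enum_valK.
Qed.

Lemma prefix_natP x n : 0 <= x ->
  (prefix_nat x n)%:R <= b%:R ^+ n * x < (prefix_nat x n).+1%:R.
Proof. by move=> x0; apply: truncn_itv; rewrite mulr_ge0// ltW. Qed.

Lemma prefix_nat_div x n : 0 <= x -> (prefix_nat x n.+1 %/ b)%N = prefix_nat x n.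
Proof.
move=> x0; apply/esym/truncn_def.
have /andP[lo hi] := prefix_natP n.+1 x0.
have := divn_eq (prefix_nat x n.+1) b.
have := ltn_pmod (prefix_nat x n.+1) b_gt0.
set p := prefix_nat _ _ in lo hi *; set c := (_ %/ _)%N; set r := (_ %% _)%N => rb pE.
have c1 : (c * b)%:R <= b%:R * (b%:R ^+ n * x) :> R.
  by rewrite mulrA -exprS (le_trans _ lo)// ler_nat pE leq_addr.
have c2 : b%:R * (b%:R ^+ n * x) < (c.+1 * b)%:R :> R.
  by rewrite mulrA -exprS (lt_le_trans hi)// ler_nat pE mulSn addnC ltn_add2r.
rewrite natrM mulrC ler_pM2l ?ltr0n// in c1.
by rewrite natrM mulrC ltr_pM2r ?ltr0n// in c2; rewrite c1.
Qed.

Lemma prefix_nat_digit x n : 0 <= x < 1 -> prefix_nat x n = word_val (digit x) n.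
Proof.
move=> /andP[x0 x1]; elim: n => [|n IH] /=.
  by apply: truncn_def; rewrite expr0 mul1r x0.
rewrite -IH rank_nth ?ltn_pmod// -(prefix_nat_div n x0); exact: divn_eq.
Qed.

Lemma word_val_lt w n : (word_val w n < b ^ n)%N.
Proof.
elim: n => [|n IH]; first by rewrite expn0.
rewrite expnSr /= (leq_trans (_ : _ < (word_val w n).+1 * b)%N)//.
  by rewrite mulSn addnC ltn_add2r ltn_ord.
by rewrite leq_mul2r IH orbT.
Qed.

Lemma eq_word_val w w' n : {in gtn n, w =1 w'} -> word_val w n = word_val w' n.
Proof.
elim: n => //= n IH ww; rewrite IH => [|t tn]; last by rewrite ww// inE ltnW.
by rewrite ww// inE.
Qed.

Lemma word_valS_mod w n : (word_val w n.+1 %% b)%N = enum_rank (w n).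
Proof. by rewrite /= modnMDl modn_small// ltn_ord. Qed.

Lemma word_valS_div w n : (word_val w n.+1 %/ b)%N = word_val w n.
Proof. by rewrite /= divnMDl// divn_small ?addn0. Qed.

Lemma word_val_inj w w' n : word_val w n = word_val w' n -> {in gtn n, w =1 w'}.
Proof.
elim: n => // n IH e t; rewrite inE ltnS leq_eqVlt => /orP[/eqP->|tn].
  by apply: enum_rank_inj; apply: val_inj; rewrite /= -!word_valS_mod e.
by apply: IH => //; rewrite -(word_valS_div w) -(word_valS_div w') e.
Qed.

(** Subtraction-free form of the fact that changing the first [n] digits shifts the prefix of length
    [n + j] by [b ^ j] times the shift of the prefix of length [n]. *)
Lemma word_val_cat w w' n j : (forall t, (n <= t)%N -> w t = w' t) ->
  (word_val w' (n + j) + b ^ j * word_val w n =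
   word_val w (n + j) + b ^ j * word_val w' n)%N.
Proof.
move=> ww; elim: j => [|j IH]; first by rewrite addn0 expn0 !mul1n addnC.
rewrite addnS /= expnS (ww _ (leq_addr j n)).
have := congr1 (muln b) IH; rewrite !mulnDr !mulnA ![(b * word_val _ _)%N]mulnC.
by move=> e; rewrite addnAC e addnAC.
Qed.

(** The truncation inequalities of [x] at every length [n + j] are translated to [x']. So [w] is the
    expansion of [x'] obtained by truncation, with no exceptional points. *)
Lemma change_prefix x w n : 0 <= x < 1 ->
  (forall t, (n <= t)%N -> digit x t = w t) ->
  let x' := x + ((word_val w n)%:R - (prefix_nat x n)%:R) / b%:R ^+ n in
  0 <= x' < 1 /\ digit x' = w.
Proof.
move=> x01 xw x'; have /andP[x0 x1] := x01.
have bb : (b%:R ^+ n) * x' = b%:R ^+ n * x + (word_val w n)%:R - (prefix_nat x n)%:R.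
  by rewrite /x' mulrDr [X in _ + X]mulrC divfK ?gt_eqF ?bX_gt0// addrA.
have main j : (word_val w (n + j))%:R <= b%:R ^+ (n + j) * x' <
    (word_val w (n + j)).+1%:R.
  have /andP[] := prefix_natP (n + j) x0.
  have := word_val_cat j xw; rewrite -!prefix_nat_digit//.
  move=> /(congr1 (fun k => k%:R : R)); rewrite -[(word_val w _).+1]addn1.
  rewrite -[(prefix_nat _ _).+1]addn1 !natrD !natrM natrX !exprD.
  rewrite [_ ^+ n * _ * x']mulrAC bb [_ ^+ n * _ * x]mulrAC.
  by move=> e h1 h2; apply/andP; split; nra.
have x'01 : 0 <= x' < 1.
  have /andP[h1 h2] := main 0%N; rewrite addn0 in h1 h2.
  rewrite -(pmulr_rge0 _ (bX_gt0 n)) (le_trans _ h1) ?ler0n//=.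
  rewrite -(ltr_pM2l (bX_gt0 n)) mulr1 (lt_le_trans h2)//.
  by rewrite -natrX ler_nat word_val_lt.
split => //; have /andP[x'0 x'1] := x'01.
(* [main] covers the lengths at least [n]; shorter prefixes follow by dropping digits. *)
have pre m : prefix_nat x' m = word_val w m.
  suff H j : (j <= n + m)%N -> prefix_nat x' (n + m - j) = word_val w (n + m - j).
    by have := H n (leq_addr _ _); rewrite addKn.
  elim: j => [_|j IH jnm]; first by rewrite subn0; apply: truncn_def.
  rewrite -prefix_nat_div// -word_valS_div subnS prednK ?subn_gt0//.
  by rewrite IH// ltnW.
by apply/funext => t; rewrite /digit pre word_valS_mod nth_enum_rank.
Qed.

Lemma digit_inj x y : 0 <= x < 1 -> 0 <= y < 1 -> digit x = digit y -> x = y.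
Proof.
wlog xy : x y / x <= y => [wl x01 y01 e|x01 y01 e].
  have [xy|/ltW yx] := leP x y; first exact: wl.
  by apply/esym/wl.
apply/eqP; rewrite eq_le xy /= leNgt; apply/negP => lxy.
have yx0 : 0 < y - x by rewrite subr_gt0.
set n := Num.truncn ((y - x)^-1).
have := truncnS_gt (y - x)^-1; rewrite -/n => hn.
have /andP[x0 _] := x01; have /andP[y0 _] := y01.
have /andP[p1 _] := prefix_natP n.+1 x0; have /andP[_ p2] := prefix_natP n.+1 y0.
rewrite prefix_nat_digit// e -prefix_nat_digit// in p1.
have : b%:R ^+ n.+1 * (y - x) < 1.
  by rewrite mulrBr ltrBlDr (lt_le_trans p2)// -natr1 addrC lerD2l.
apply/negP; rewrite -leNgt.
rewrite -[leLHS](mulVf (lt0r_neq0 yx0)) ler_pM2r// (le_trans (ltW hn))//.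
by rewrite -natrX ler_nat ltnW// ltn_expl.
Qed.

End Digits.

Section DigitSystem.
Context (R : realType) (D : finType) (d0 : D).
Hypothesis D_gt1 : (1 < #|D|)%N.
Local Notation b := #|D|.
Local Notation digit := (@digit R D d0).

Let b_gt0 : (0 < b)%N. Proof. exact: ltn_trans D_gt1. Qed.

Let bX_gt0 n : 0 < b%:R ^+ n :> R. Proof. by rewrite exprn_gt0// ltr0n. Qed.

Definition prefix_cell n (p : nat) : set R :=
  `[p%:R / b%:R ^+ n, p.+1%:R / b%:R ^+ n[%classic.

Lemma prefix_cellP n p x : (p < b ^ n)%N -> prefix_cell n p x ->
  0 <= x < 1 /\ prefix_nat D x n = p.
Proof.
move=> pb; rewrite /prefix_cell /= in_itv/= ler_pdivrMr// ltr_pdivlMr//.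
rewrite mulrC => px.
have x0 : 0 <= x.
  by case/andP: px => p1 _; rewrite -(pmulr_rge0 _ (bX_gt0 n)) (le_trans _ p1).
split; last exact: truncn_def.
case/andP: px => _ p2; rewrite x0/= -(ltr_pM2l (bX_gt0 n)) mulr1 (lt_le_trans p2)//.
by rewrite -natrX ler_nat.
Qed.

Lemma mem_prefix_cell n (x : R) : 0 <= x < 1 -> prefix_cell n (prefix_nat D x n) x.
Proof.
move=> /andP[x0 _]; rewrite /prefix_cell /= in_itv/= ler_pdivrMr// ltr_pdivlMr//.
by rewrite mulrC prefix_natP.
Qed.

Lemma prefix_nat_lt n (x : R) : 0 <= x < 1 -> (prefix_nat D x n < b ^ n)%N.
Proof. by move=> x01; rewrite (prefix_nat_digit d0)// word_val_lt. Qed.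

Lemma bigU_prefix_cell n : \big[setU/set0]_(p < b ^ n) prefix_cell n p = `[0, 1[%classic.
Proof.
rewrite -(bigcup_mkord _ (prefix_cell n)); apply/seteqP; split=> [x [p /= pb]|x].
  by move=> /(prefix_cellP pb)[x01 _]; rewrite in_itv.
rewrite /= in_itv/= => x01; exists (prefix_nat D x n); first exact: prefix_nat_lt.
exact: mem_prefix_cell.
Qed.

Lemma trivIset_prefix_cell n : trivIset setT (prefix_cell n).
Proof.
apply/trivIsetP => p q _ _; apply: contra_neqP => /eqP/set0P[x []].
rewrite /prefix_cell /= !in_itv/= !ler_pdivrMr// !ltr_pdivlMr// => xp xq.
by rewrite -(truncn_def xp) -(truncn_def xq).
Qed.

Lemma unit_outer_prefix_cells n (A : set R) :
  unit_outer A = (\sum_(p < b ^ n) lebesgue_outer (A `&` prefix_cell n p))%E.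
Proof.
rewrite -(@caratheodory_additive _ _ (@lebesgue_outer R) (prefix_cell n))//.
- by rewrite bigU_prefix_cell.
- by move=> p; exact: caratheodory_itv.
- exact: trivIset_prefix_cell.
Qed.

Lemma lebesgue_outer_prefix_cell n p :
  lebesgue_outer (prefix_cell n p) = ((b%:R ^+ n)^-1)%:E.
Proof.
rewrite /prefix_cell lebesgue_outer_itv; last first.
  by rewrite ler_pM2r ?invr_gt0// ler_nat.
by rewrite -mulrBl -natrB// subSnn mul1r.
Qed.

Context (Gam : zmodType) (tau : Gam -> (nat -> D) -> (nat -> D)) (bnd : Gam -> nat).
Hypothesis tau0 : forall w, tau 0 w = w.
Hypothesis tauD : forall g h w, tau (g + h) w = tau g (tau h w).
Hypothesis tau_far : forall g w t, (bnd g <= t)%N -> tau g w t = w t.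
Hypothesis tau_near : forall g w w', {in gtn (bnd g), w =1 w'} ->
  {in gtn (bnd g), tau g w =1 tau g w'}.

Let tau_inj g : injective (tau g).
Proof.
by move=> w w' e; rewrite -[w]tau0 -[w']tau0 -(addNr g) !tauD e.
Qed.

Let tau_near_le g n w w' : (bnd g <= n)%N -> {in gtn n, w =1 w'} ->
  {in gtn n, tau g w =1 tau g w'}.
Proof.
move=> gn ww t tn; have [gt|tg] := leqP (bnd g) t; first by rewrite !tau_far// ww.
by apply: tau_near => // u; rewrite inE => ug; apply: ww; rewrite inE (leq_trans ug).
Qed.

(* For [x] in the unit interval, [digit_act g x] is the number whose digits are those
   of [x] moved by [tau g]; as [tau g] only changes the first [bnd g] digits, [g] acts
   by exchanging the cells of level [bnd g] by translations. *)
Definition digit_act g (x : R) : R :=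
  if 0 <= x < 1 then
    x + ((word_val (tau g (digit x)) (bnd g))%:R - (prefix_nat D x (bnd g))%:R)
        / b%:R ^+ bnd g
  else x.

Lemma digit_actP g (x : R) : 0 <= x < 1 ->
  0 <= digit_act g x < 1 /\ digit (digit_act g x) = tau g (digit x).
Proof.
move=> x01; rewrite /digit_act x01; apply: change_prefix => // t gt.
by rewrite tau_far.
Qed.

Lemma digit_act_out g x : ~~ (0 <= x < 1) -> digit_act g x = x.
Proof. by rewrite /digit_act => /negbTE->. Qed.

Lemma digit_act_in g x : (0 <= digit_act g x < 1) = (0 <= x < 1).
Proof.
have [x01|x01] := boolP (0 <= x < 1); first by have [->] := digit_actP g x01.
by rewrite digit_act_out// (negbTE x01).
Qed.

Lemma digit_act0 x : digit_act 0 x = x.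
Proof.
have [x01|/digit_act_out->//] := boolP (0 <= x < 1).
have [y01 e] := digit_actP 0 x01.
by apply: (digit_inj D_gt1 (d0 := d0)) => //; rewrite e tau0.
Qed.

Lemma digit_actD g h x : digit_act (g + h) x = digit_act g (digit_act h x).
Proof.
have [x01|x01] := boolP (0 <= x < 1); last by rewrite !digit_act_out// digit_act_in.
have [y01 ey] := digit_actP h x01.
have [z01 ez] := digit_actP g y01.
have [u01 eu] := digit_actP (g + h) x01.
by apply: (digit_inj D_gt1 (d0 := d0)) => //; rewrite eu ez ey tauD.
Qed.

Let cell_perm g (p : 'I_(b ^ bnd g)) : 'I_(b ^ bnd g) :=
  Ordinal (word_val_lt
    (tau g (digit (p%:R / b%:R ^+ bnd g))) (bnd g)).

Let cell_left n (p : 'I_(b ^ n)) :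
  0 <= (p%:R / b%:R ^+ n : R) < 1 /\ prefix_nat D (p%:R / b%:R ^+ n : R) n = p.
Proof.
apply: prefix_cellP => //; rewrite /prefix_cell/= in_itv/= lexx/=.
by rewrite ltr_pM2r ?invr_gt0// ltr_nat.
Qed.

Let cell_perm_inj g : injective (@cell_perm g).
Proof.
move=> p q /(congr1 val)/= /word_val_inj.
set u := digit _; set v := digit _ => uv.
(* Injectivity of [tau g] concerns infinite words, so the prefix of [u] is joined to the tail of
   [v]. *)
pose w t := if (t < bnd g)%N then u t else v t.
have wv : w = v.
  apply: (@tau_inj g); apply/funext => t; have [gt|tg] := leqP (bnd g) t.
    by rewrite !tau_far// /w ltnNge gt.
  rewrite -uv//; apply: tau_near => // r; rewrite inE => rg.
  by rewrite /w rg.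
have [p01 pE] := cell_left p; have [q01 qE] := cell_left q.
apply: val_inj; rewrite /= -pE -qE !(prefix_nat_digit d0)//.
apply: eq_word_val => t; rewrite inE => tg.
by rewrite -/u -/v -wv /w tg.
Qed.

Let digit_act_cell g (p : 'I_(b ^ bnd g)) x : prefix_cell (bnd g) p x ->
  digit_act g x = x + ((cell_perm p)%:R - p%:R) / b%:R ^+ bnd g.
Proof.
move=> px; have [x01 xp] := prefix_cellP (ltn_ord p) px.
have [p01 pE] := cell_left p.
rewrite /digit_act x01 xp /=; congr (_ + (_%:R - _) / _).
apply: eq_word_val => //; apply: tau_near; apply: word_val_inj => //.
by rewrite -!prefix_nat_digit// xp.
Qed.

(** On each cell the action is a translation into the cell given by [cell_perm], and these cells are
    permuted. The reverse inequality will follow from [- g]. *)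
Lemma digit_act_outer_le g (A : set R) :
  (unit_outer (digit_act g @^-1` A) <= unit_outer A)%E.
Proof.
rewrite !(unit_outer_prefix_cells (bnd g)) [leRHS](reindex_inj (@cell_perm_inj g)).
apply: lee_sum => p _.
apply: le_trans (lebesgue_outer_shift (((cell_perm p)%:R - p%:R) / b%:R ^+ bnd g) _).
apply: le_outer_measure => x [/= Ax px]; split.
  by rewrite /= -digit_act_cell.
have [x01 xp] := prefix_cellP (ltn_ord p) px.
rewrite /= -digit_act_cell//; have [y01 ey] := digit_actP g x01.
suff e : prefix_nat D (digit_act g x) (bnd g) = cell_perm p :> nat.
  by have := mem_prefix_cell (bnd g) y01; rewrite e.
have [p01 pE] := cell_left p.
rewrite (prefix_nat_digit d0)// ey /=.
apply: eq_word_val => //; apply: tau_near; apply: word_val_inj => //.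
by rewrite -!prefix_nat_digit// xp.
Qed.

Lemma digit_act_outer g (A : set R) : unit_outer (digit_act g @^-1` A) = unit_outer A.
Proof.
apply/eqP; rewrite eq_le digit_act_outer_le/=.
apply: le_trans (digit_act_outer_le (- g) _).
by apply: le_unit_outer => x; rewrite /= -digit_actD subrr digit_act0.
Qed.

(** An invertible map preserving the outer measure of every set carries the Caratheodory criterion
    from [A] to its preimage. *)
Lemma digit_act_measurable g :
  measurable_fun setT (digit_act g : unit_space R -> unit_space R).
Proof.
move=> _ A mA; rewrite setTI.
suff : (@unit_outer R).-caratheodory (digit_act g @^-1` A) by [].
move=> X.
have XE Y : digit_act g @^-1` (digit_act (- g) @^-1` Y) = Y.
  by apply/seteqP; split => x; rewrite /= -digit_actD addNr digit_act0.
rewrite -[X]XE preimage_setC -!preimage_setI !digit_act_outer.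
have {}mA : (@unit_outer R).-caratheodory A by [].
by rewrite -mA digit_act_outer.
Qed.

Definition digit_system : system R Gam :=
  @System R Gam _ (unit_space R) (@unit_prob R) digit_act
    (unit_space_lebesgue R) digit_act0 digit_actD digit_act_measurable
    (fun g A _ => digit_act_outer g A).

Lemma unit_space_outside_null :
  (@unit_prob R).-negligible [set x : unit_space R | ~~ (0 <= (x : R) < 1)].
Proof.
exists [set x : R | ~~ (0 <= x < 1)]; split => //.
  rewrite [X in measurable X](_ : _ = ~` (`[0, 1[%classic : set R)).
    apply: caratheodory_measurable_setC.
    exact/caratheodory_unit_outer/caratheodory_itv.
  by apply/seteqP; split => x /=; rewrite in_itv/= => /negP.
rewrite /unit_prob /unit_outer [X in lebesgue_outer X](_ : _ = set0) ?outer_measure0//.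
by apply/seteqP; split => x //= []; rewrite in_itv => /negP.
Qed.

Lemma digit_system_free :
  (forall g w, g != 0 -> tau g w <> w) -> free_system digit_system.
Proof.
move=> tau_free g g0; apply: negligibleS unit_space_outside_null => x /= gx.
apply/negP => x01; have [_] := digit_actP g x01.
by rewrite gx => /esym; exact: tau_free.
Qed.

(** As [bnd g <= m], the first [m] digits decide whether a digit changes; the event is covered by
    one cell of length [b ^ -m] for each bad word. *)
Lemma unit_outer_digit_change g (N m : nat) : (bnd g <= m)%N ->
  (unit_outer [set x : R | (0 <= x < 1)%R /\
     exists2 t, (t < N)%N & tau g (digit x) t <> digit x t] <=
   (#|[set w : {ffun 'I_m -> D} | [exists t : 'I_N,
        tau g (ext_word d0 w) t != ext_word d0 w t]]|%:R / b%:R ^+ m)%:E)%E.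
Proof.
move=> gm; set bad := [set w : {ffun _} | _].
apply: (@le_trans _ _ (lebesgue_outer (\big[setU/set0]_(w in bad)
    prefix_cell m (word_val (ext_word d0 w) m)))).
  apply: le_outer_measure => x [[x01 [t tN tx]] _].
  pose w := [ffun o : 'I_m => digit x o].
  have we : {in gtn m, ext_word d0 w =1 digit x}.
    by move=> u; rewrite inE => um; rewrite (ext_word_finfun d0 (digit x)).
  have tm : (t < m)%N.
    by rewrite ltnNge; apply: contra_notN tx => mt; rewrite tau_far// (leq_trans gm).
  have wbad : w \in bad.
    rewrite inE; apply/existsP; exists (Ordinal tN) => /=.
    by apply/eqP; rewrite (tau_near_le gm we)// we.
  rewrite (bigD1 w)//=; left; rewrite (eq_word_val we) -prefix_nat_digit//.
  exact: mem_prefix_cell.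
apply: (@le_trans _ _ (\sum_(w in bad) ((b%:R ^+ m)^-1)%:E)%E).
  elim/big_rec2: _ => [|w s A _ IH]; first by rewrite outer_measure0.
  rewrite -(lebesgue_outer_prefix_cell m (word_val (ext_word d0 w) m)).
  by apply: le_trans (outer_measureU2 _ _ _) _; exact: leeD2l.
by rewrite sumEFin sumr_const mulr_natl.
Qed.

End DigitSystem.

End DigitExpansions.

(** * Rigidity *)

Section RigidityCriterion.
Local Open Scope classical_set_scope.
Local Open Scope ring_scope.

(* Reduces convergence in [L^2] of [f] to convergence in [L^1] of [f * `|f|]. *)
Lemma sqr_sub_le_signed (R : realDomainType) (x y : R) :
  `|x - y| ^+ 2 <= 2 * `|x * `|x| - y * `|y| |.
Proof.
wlog yx : x y / y <= x => [wl|].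
  have [/wl//|/ltW/wl] := leP y x.
  by rewrite distrC [X in 2 * X]distrC.
rewrite real_normK ?num_real//.
suff : (x - y) ^+ 2 <= 2 * (x * `|x| - y * `|y|).
  by have := ler_norm (x * `|x| - y * `|y|); lra.
have [x0|/ltW x0] := lerP 0 x; have [y0|/ltW y0] := lerP 0 y;
  rewrite ?(ger0_norm x0) ?(ler0_norm x0) ?(ger0_norm y0) ?(ler0_norm y0).
- have : 0 <= (x - y) * (x + 3 * y) by rewrite mulr_ge0//; lra.
  by lra.
- have : 0 <= (x + y) ^+ 2 by exact: sqr_ge0.
  by lra.
- have -> : y = 0 by lra.
  have -> : x = 0 by lra.
  by lra.
- have : 0 <= (x - y) * (- (3 * x) - y) by rewrite mulr_ge0//; lra.
  by lra.
Qed.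

Section Rigidity.
Import HBSimple.
Context (R : realType) (Gam : zmodType) (S : system R Gam) (a : nat -> Gam).
Local Notation P := (prob S).
Local Notation X := (sys_space S).
Local Notation T n := (@act R Gam S (a n)).
Local Open Scope ereal_scope.

Definition eventually_small (u : nat -> \bar R) :=
  forall e : R, (0 < e)%R -> exists n0, forall n, (n0 <= n)%N -> u n <= e%:E.

Lemma eventually_small_le u v : (forall n, u n <= v n) ->
  eventually_small v -> eventually_small u.
Proof.
move=> uv sv e e0; have [n0 H] := sv e e0.
by exists n0 => n /H; exact: le_trans.
Qed.

Lemma eventually_smallD u v : eventually_small u -> eventually_small v ->
  eventually_small (fun n => u n + v n).
Proof.
move=> su sv e e0; have e2 : (0 < e / 2)%R by rewrite divr_gt0.
have [n1 H1] := su _ e2; have [n2 H2] := sv _ e2.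
exists (maxn n1 n2) => n; rewrite geq_max => /andP[/H1 h1 /H2 h2].
by rewrite [e](splitr e) EFinD leeD.
Qed.

Lemma eventually_smallZ (c : R) u : (0 <= c)%R -> eventually_small u ->
  eventually_small (fun n => c%:E * u n).
Proof.
move=> c0 su e e0; have c1 : (0 < c + 1)%R by rewrite ltr_wpDl.
have [n0 H] := su (e / (c + 1))%R (divr_gt0 e0 c1).
exists n0 => n /H un; apply: (@le_trans _ _ (c%:E * (e / (c + 1))%:E)).
  by rewrite lee_wpmul2l// lee_fin.
rewrite -EFinM lee_fin mulrCA ger_pMr//.
by rewrite ler_pdivrMr// mul1r lerDl.
Qed.

Let mT n : measurable_fun setT (T n). Proof. exact: act_measurable. Qed.

Lemma integral_act g (f : X -> \bar R) : measurable_fun setT f ->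
  (forall x, 0 <= f x) -> \int[P]_x f (act g x) = \int[P]_x f x.
Proof.
move=> mf f0; have mg := @act_measurable R Gam S g.
have := @ge0_integral_pushforward _ _ X X R (act g) mg P setT f measurableT mf.
rewrite preimage_setT => <-; last by move=> y _; exact: f0.
apply: eq_measure_integral => A mA _; exact: act_preserving.
Qed.

Definition moved (A : set X) n : set X :=
  (A `\` T n @^-1` A) `|` (T n @^-1` A `\` A).

Let L1_fixed (f : X -> R) := eventually_small (fun n =>
  \int[P]_x `|(f x - f (T n x))%:E|).

Let mTset n A : measurable A -> measurable (T n @^-1` A).
Proof. by move=> mA; rewrite -[_ @^-1` _]setTI; exact: mT. Qed.

Let measurable_moved A n : measurable A -> measurable (moved A n).
Proof.
by move=> mA; apply: measurableU; apply: measurableD => //; exact: mTset.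
Qed.

Let measurable_diff n (f : X -> R) : measurable_fun setT f ->
  measurable_fun setT (fun x => `|(f x - f (T n x))%:E|).
Proof.
move=> mf; apply: measurableT_comp => //; apply/measurable_EFinP.
by apply: measurable_funB => //; exact: measurableT_comp.
Qed.

Let mem_moved A n x : (x \in moved A n) = (x \in A) (+) (T n x \in A).
Proof.
have preE : (x \in T n @^-1` A) = (T n x \in A).
  by apply/idP/idP => /set_mem ?; exact: mem_set.
by rewrite /moved in_setU !in_setD preE; case: (x \in A); case: (_ \in A).
Qed.

Let L1_fixed_indic A : measurable A -> eventually_small (P \o moved A) ->
  L1_fixed \1_A.
Proof.
move=> mA; apply: eventually_small_le => n /=.
rewrite -[X in P X]setIT -integral_indic//; last exact: measurable_moved.
apply: ge0_le_integral => //.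
- by apply: measurable_diff; exact: measurable_indic.
- by apply/measurable_EFinP/measurable_indic/measurable_moved.
move=> x _; rewrite lee_fin !indicE mem_moved.
by case: (x \in A); case: (T n x \in A) => /=;
  rewrite ?subrr ?normr0 ?subr0 ?sub0r ?normrN ?normr1.
Qed.

Let L1_fixedD (f g : X -> R) : measurable_fun setT f -> measurable_fun setT g ->
  L1_fixed f -> L1_fixed g -> 
  L1_fixed (fun x => f x + g x)%R.
Proof.
move=> mf mg Lf Lg; apply: eventually_small_le (eventually_smallD Lf Lg) => n.
rewrite -ge0_integralD//; [|exact: measurable_diff|exact: measurable_diff].
apply: ge0_le_integral => //.
- by apply: measurable_diff; exact: measurable_funD.
- by apply: emeasurable_funD; exact: measurable_diff.
move=> x _; rewrite -EFinD lee_fin /= opprD addrACA; exact: ler_normD.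
Qed.

Let L1_fixedZ (c : R) (f : X -> R) : measurable_fun setT f -> L1_fixed f ->
  L1_fixed (fun x => c * f x)%R.
Proof.
move=> mf Lf; apply: eventually_small_le (eventually_smallZ (normr_ge0 c) Lf) => n.
rewrite -ge0_integralZl_EFin//; last exact: measurable_diff.
apply: ge0_le_integral => //.
- by apply: measurable_diff; exact: measurable_funM.
- by apply: measurable_funeM; exact: measurable_diff.
by move=> x _; rewrite -EFinM lee_fin -mulrBr normrM.
Qed.

Hypothesis moved_small : forall A, measurable A -> eventually_small (P \o moved A).

Let L1_fixed_sfun (g : {sfun X >-> R}) : L1_fixed (fun x => g x).
Proof.
rewrite (_ : (fun x => g x) = fun x =>
  (\sum_(y \in range g) y * \1_(g @^-1` [set y]) x)%R); last first.
  by apply/funext => x; exact: fimfunE.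
under eq_fun do rewrite fsbig_finite//.
have : forall s : seq R,
   measurable_fun setT (fun x : X => (\sum_(y <- s) y * \1_(g @^-1` [set y]) x)%R) /\
   L1_fixed (fun x : X => \sum_(y <- s) y * \1_(g @^-1` [set y]) x)%R.
  elim=> [|y s [ms Ls]].
    under eq_fun do rewrite big_nil; split => // e e0; exists 0%N => n _.
    by rewrite integral0_eq ?lee_fin ?ltW// => x _; rewrite subrr abse0.
  under eq_fun do rewrite big_cons.
  have my : measurable (g @^-1` [set y]) by exact: measurable_sfunP.
  have m1 : measurable_fun setT (fun x => y * \1_(g @^-1` [set y]) x)%R.
    by apply: measurable_funM => //; exact: measurable_indic.
  split; first exact: measurable_funD.
  apply: L1_fixedD => //; apply: L1_fixedZ; first exact: measurable_indic.
  by apply: L1_fixed_indic => //; exact: moved_small.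
by move=> H; exact: (H _).2.
Qed.

(** Approximate [f] by a simple function [g] up to [e / 3] in [L^1]; by invariance of the measure,
    composing both with [T n] gives the same error. *)
Let L1_fixed_integrable (f : X -> R) : P.-integrable setT (EFin \o f) -> L1_fixed f.
Proof.
move=> intf e e0; have e3 : (0 < e / 3)%R by rewrite divr_gt0.
have mf : measurable_fun setT f by apply/measurable_EFinP; exact: (measurable_int _ intf).
have [g_ [_ _ gf]] := approximation_sfun_integrable measurableT intf.
have [k hk] : exists k, \int[P]_x `|(f x)%:E - (g_ k x)%:E| <= (e / 3)%:E.
  move/fine_cvgP : gf => [+ /cvgrPdist_le/(_ _ e3)] => -[n1 _ H1] [n2 _ H2].
  exists (maxn n1 n2); have := H2 (maxn n1 n2) (leq_maxr _ _).
  rewrite sub0r normrN => h; rewrite -(fineK (H1 _ (leq_maxl n1 n2))) lee_fin.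
  by rewrite (le_trans _ h)// ler_norm.
pose g x := g_ k x; have mg : measurable_fun setT g by exact: measurable_funP.
have [n0 H] := L1_fixed_sfun (g_ k) e3.
exists n0 => n /H Hn.
pose u x := `|(f x - g x)%:E|.
have mu : measurable_fun setT u.
  by apply: measurableT_comp => //; apply/measurable_EFinP; exact: measurable_funB.
have uT : \int[P]_x u (T n x) = \int[P]_x u x.
  by apply: integral_act => // x; exact: abse_ge0.
apply: (@le_trans _ _ (\int[P]_x (u x + (`|(g x - g (T n x))%:E| + u (T n x))))).
  apply: ge0_le_integral => //.
  - exact: measurable_diff.
  - apply: emeasurable_funD => //; apply: emeasurable_funD.
      exact: measurable_diff.
    exact: measurableT_comp.
  move=> x _; rewrite /u -!EFinD lee_fin.
  have -> : (f x - f (T n x) =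
      (f x - g x) + ((g x - g (T n x)) - (f (T n x) - g (T n x))))%R.
    by ring.
  rewrite (le_trans (ler_normD _ _))// lerD2l (le_trans (ler_normB _ _))//.
have u0 x : 0 <= u x by exact: abse_ge0.
have mv : measurable_fun setT (fun x => `|(g x - g (T n x))%:E| + u (T n x)).
  by apply: emeasurable_funD; [exact: measurable_diff|exact: measurableT_comp].
have v0 x : 0 <= `|(g x - g (T n x))%:E| + u (T n x) by rewrite adde_ge0.
rewrite (ge0_integralD P measurableT (fun x _ => u0 x) mu (fun x _ => v0 x) mv).
rewrite ge0_integralD//; [|exact: measurable_diff|exact: measurableT_comp].
rewrite uT (_ : e%:E = (e / 3)%:E + ((e / 3)%:E + (e / 3)%:E)).
  by rewrite leeD// leeD.
by rewrite -!EFinD; congr EFin; field.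
Qed.

Lemma rigidity_of_moved : rigidity_sequence S a.
Proof.
move=> f f2.
have mf : measurable_fun setT f by move: f2; rewrite inE => /andP[]; rewrite inE.
pose F x := (f x * `|f x|)%R.
have mF : measurable_fun setT F.
  by apply: measurable_funM => //; exact: measurableT_comp.
have intF : P.-integrable setT (EFin \o F).
  apply: le_integrable (Lfun2_integrable_sqr f2) => //; first exact/measurable_EFinP.
  by move=> x _; rewrite /= lee_fin /F normrM normr_id -normrM -expr2.
have small : eventually_small (fun n => 'N[P]_2%:E[EFin \o ((f \o T n) \- f)%R]).
  move=> e e0; have e2 : (0 < e ^+ 2 / 2)%R by rewrite divr_gt0// exprn_gt0.
  have [n0 H] := L1_fixed_integrable intF e2.
  exists n0 => n /H {}H.
  rewrite unlock.
  have le2 : \int[P]_x `|(EFin \o ((f \o T n) \- f)%R) x| `^ 2 <= (e ^+ 2)%:E.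
    apply: (@le_trans _ _ (2%:E * \int[P]_x `|(F x - F (T n x))%:E|)).
      rewrite -ge0_integralZl_EFin//; last exact: measurable_diff.
      apply: ge0_le_integral => //.
      - by move=> x _; exact: poweR_ge0.
      - apply: (measurableT_comp (measurable_poweR _)); apply: measurableT_comp => //.
        by apply/measurable_EFinP/measurable_funB => //; exact: measurableT_comp.
      - by apply: measurable_funeM; exact: measurable_diff.
      move=> x _; rewrite /= lee_fin powR_mulrn// distrC; exact: sqr_sub_le_signed.
    apply: le_trans (lee_wpmul2l _ H) _ => //; rewrite -EFinM lee_fin mulrC divfK//.
  apply: (@le_trans _ _ ((e ^+ 2)%:E `^ 2^-1)).
    rewrite gt0_ler_poweR// in_itv/= leey andbT; first exact: integral_ge0.
    by rewrite lee_fin sqr_ge0.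
  by rewrite poweR_EFin lee_fin -(powR_mulrn 2 (ltW e0)) -powRrM divff// powRr1 ?(ltW e0).
have finN n (e : R) : 'N[P]_2%:E[EFin \o ((f \o T n) \- f)%R] <= e%:E ->
    'N[P]_2%:E[EFin \o ((f \o T n) \- f)%R] \is a fin_num.
  by move=> h; rewrite ge0_fin_numE ?Lnorm_ge0// (le_lt_trans h)// ltry.
apply/fine_cvgP; split.
  by have [n0 H] := small 1%R ltr01; exists n0 => // n /= /H /finN.
apply/cvgrPdist_le => e e0; have [n0 H] := small e e0; exists n0 => // n /= /H h.
rewrite sub0r normrN ger0_norm ?fine_ge0 ?Lnorm_ge0//.
by rewrite -lee_fin fineK// (finN _ e).
Qed.

End Rigidity.

Section DigitRigidity.
Context (R : realType) (D : finType) (d0 : D).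
Hypothesis D_gt1 : (1 < #|D|)%N.
Local Notation b := #|D|.
Local Notation digit := (@digit R D d0).
Context (Gam : zmodType) (tau : Gam -> (nat -> D) -> (nat -> D)) (bnd : Gam -> nat).
Hypothesis tau0 : forall w, tau 0 w = w.
Hypothesis tauD : forall g h w, tau (g + h) w = tau g (tau h w).
Hypothesis tau_far : forall g w t, (bnd g <= t)%N -> tau g w t = w t.
Hypothesis tau_near : forall g w w', {in gtn (bnd g), w =1 w'} ->
  {in gtn (bnd g), tau g w =1 tau g w'}.
Variable u : nat -> Gam.
Hypothesis few_changes : forall (N : nat) (e : R), 0 < e ->
  exists n0, forall n, (n0 <= n)%N -> exists2 m, (bnd (u n) <= m)%N &
    #|[set w : {ffun 'I_m -> D} | [exists t : 'I_N,
        tau (u n) (ext_word d0 w) t != ext_word d0 w t]]|%:R / b%:R ^+ m <= e.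

Local Notation T n := (digit_act d0 tau bnd (u n) : R -> R).
Local Open Scope ereal_scope.

Let moved (A : set R) n : set R := (A `\` T n @^-1` A) `|` (T n @^-1` A `\` A).

Let fixed (A : set R) := eventually_small (fun n => unit_outer (moved A n)).

Let b_gt0 : (0 < b)%N. Proof. exact: ltn_trans D_gt1. Qed.

Let bX_gt0 n : (0 < b%:R ^+ n :> R)%R. Proof. by rewrite exprn_gt0// ltr0n. Qed.

(** Cells of level [N.+1] are shorter than [h], so a point of [[0, 1[] displaced by at least [h]
    changes one of its first [N.+1] digits. *)
Let displacement_small (h : R) : (0 < h)%R ->
  eventually_small (fun n => unit_outer [set x | (h <= `|T n x - x|)%R]).
Proof.
move=> h0 e e0; pose N := Num.truncn h^-1.
have hN : (b%:R ^- N.+1 < h)%R.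
  rewrite -[ltRHS]invrK ltf_pV2 ?posrE ?invr_gt0 ?bX_gt0//.
  rewrite (lt_le_trans (truncnS_gt _))// -/N -natrX ler_nat ltnW// ltn_expl//.
have [n0 H] := few_changes N.+1 e0; exists n0 => n /H[m gm small].
have sm : (#|[set w : {ffun 'I_m -> D} | [exists t : 'I_N.+1,
    tau (u n) (ext_word d0 w) t != ext_word d0 w t]]|%:R / b%:R ^+ m)%:E <= e%:E.
  by rewrite lee_fin.
apply: le_trans (le_trans
  (unit_outer_digit_change R d0 D_gt1 tau_far tau_near N.+1 gm) sm).
rewrite /unit_outer; apply: le_outer_measure => x [/= hx].
rewrite in_itv/= => x01; split => //.
split=> //; apply: contrapT => noch.
have [y01 ey] := digit_actP d0 D_gt1 tau_far (u n) x01.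
have : prefix_nat D (T n x) N.+1 = prefix_nat D x N.+1.
  rewrite !(prefix_nat_digit d0)// ey; apply: eq_word_val => t; rewrite inE => tN.
  by apply: contrapT => ch; apply: noch; exists t.
have /andP[x0 _] := x01; have /andP[y0 _] := y01.
have := prefix_natP D N.+1 x0; have := prefix_natP D N.+1 y0.
set p := prefix_nat _ _ _; set q := prefix_nat _ _ _ => /andP[y1 y2] /andP[x1 x2] pq.
rewrite pq in y1 y2; apply/negP : hx; rewrite -ltNge.
apply: le_lt_trans hN; rewrite -(ler_pM2l (bX_gt0 N.+1)) divff ?gt_eqF//.
rewrite -{1}(gtr0_norm (bX_gt0 N.+1)) -normrM mulrBr ler_norml.
by move: x1 x2 y1 y2; rewrite -natr1; set X := (_ * x)%R; set Y := (_ * _)%R; lra.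
Qed.

(** A point crossing [c] is displaced by at least [e / 4] or lies within [e / 4] of [c]; each case
    contributes at most [e / 2]. *)
Let fixed_ray c : fixed `]-oo, c].
Proof.
move=> e e0; have h0 : (0 < e / 4)%R by rewrite divr_gt0.
have [n0 H] := displacement_small h0 (divr_gt0 e0 (ltr0Sn R 1)).
exists n0 => n /H {}H.
apply: (@le_trans _ _ (unit_outer ([set x | (e / 4 <= `|T n x - x|)%R] `|`
    `[(c - e / 4)%R, (c + e / 4)%R]))).
  apply: le_unit_outer => x; rewrite /moved /= !in_itv/=.
  have [|lt] := lerP (e / 4)%R `|T n x - x|%R; first by left.
  move: lt; rewrite ltr_norml => /andP[l1 l2] h; right; apply/andP.
  by case: h => -[h1 /negP]; rewrite -ltNge => h2; split; lra.
apply: le_trans (outer_measureU2 _ _ _) _.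
rewrite [e in leRHS](splitr e) EFinD leeD//.
apply: (@le_trans _ _ (lebesgue_outer `[(c - e / 4)%R, (c + e / 4)%R])).
  by apply: le_outer_measure; exact: subIsetl.
rewrite lebesgue_outer_itv; last by lra.
by rewrite lee_fin; lra.
Qed.

Let fixed_le (A B C : set R) : (forall n, moved C n `<=` moved A n `|` moved B n) ->
  fixed A -> fixed B -> fixed C.
Proof.
move=> sub fA fB; apply: eventually_small_le (eventually_smallD fA fB) => n.
apply: le_trans (outer_measureU2 _ _ _); exact: le_unit_outer.
Qed.

Let fixed_set0 : fixed set0.
Proof.
move=> e e0; exists 0%N => n _.
rewrite (_ : moved set0 n = set0) ?unit_outer0 ?lee_fin ?ltW//.
by apply/seteqP; split => x // -[] [].
Qed.

Let fixedU A B : fixed A -> fixed B -> fixed (A `|` B).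
Proof.
by apply: fixed_le => n x; rewrite /moved/=; case: (pselect (A x)) (pselect (B x))
  (pselect (A (T n x))) (pselect (B (T n x))) => + [] + [] + [] => ? ? ? ?; tauto.
Qed.

Let fixed_itv (x y : R) : fixed `]x, y].
Proof.
apply: fixed_le (fixed_ray x) (fixed_ray y) => n z; rewrite /moved /= !in_itv/=.
set z' := T n z; have [] := lerP z x; have [] := lerP z' x; have [] := lerP z y;
  have [] := lerP z' y => /= *; intuition.
Qed.

Let fixed_approx (A : set R) : (forall e : R, (0 < e)%R -> exists E, [/\ fixed E,
    unit_outer (A `\` E) <= e%:E & unit_outer (E `\` A) <= e%:E]) -> fixed A.
Proof.
move=> apx e e0; have e5 : (0 < e / 5)%R by rewrite divr_gt0.
have [E [/(_ _ e5)[n0 H] AE EA]] := apx _ e5.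
exists n0 => n /H {}H.
pose W := (A `\` E) `|` (E `\` A).
have hW : unit_outer W <= (e / 5)%:E + (e / 5)%:E.
  by apply: le_trans (outer_measureU2 _ _ _) _; exact: leeD.
apply: (@le_trans _ _ (unit_outer (W `|` (moved E n `|` T n @^-1` W)))).
  apply: le_unit_outer => x; rewrite /moved /W/=.
  by case: (pselect (A x)) (pselect (E x)) (pselect (A (T n x)))
    (pselect (E (T n x))) => + [] + [] + [] => ? ? ? ?; tauto.
apply: le_trans (outer_measureU2 _ _ _) _.
(* Two fifths for [W], one for [moved E n], and two for the preimage of [W]. *)
have -> : e%:E = ((e / 5)%:E + (e / 5)%:E) + ((e / 5)%:E + ((e / 5)%:E + (e / 5)%:E)).
  by rewrite -!EFinD; congr EFin; field.
apply: leeD => //; apply: le_trans (outer_measureU2 _ _ _) _; apply: leeD => //.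
by rewrite -(digit_act_outer d0 D_gt1 tau0 tauD tau_far tau_near (u n)) in hW.
Qed.

(** Cover [A01] by half-open intervals of total length within [e] of its measure and keep finitely
    many, the tail having length at most [e]; a finite union of intervals is fixed. *)
Let fixed_measurable (A : set R) : (@unit_outer R).-caratheodory A -> fixed A.
Proof.
move=> mA; apply: fixed_approx => e e0.
pose A01 := A `&` `[0%R, 1%R[%classic.
have mA01 : (@lebesgue_outer R).-caratheodory A01.
  apply: unit_outer_caratheodory; first exact: subIsetr.
  apply: caratheodory_measurable_setI => //.
  exact/caratheodory_unit_outer/caratheodory_itv.
have fA : lebesgue_outer A01 \is a fin_num.
  rewrite ge0_fin_numE ?outer_measure_ge0//.
  apply: (@le_lt_trans _ _ (unit_outer setT)); first exact: le_unit_outer.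
  by rewrite (_ : unit_outer setT = 1) ?ltry//; exact: unit_probT.
have [s [F [mF AF] <-] sA] := lb_ereal_inf_adherent e0 fA.
have F0 k : 0 <= @wlength R idfun (F k) by exact: wlength_ge0.
have fs : \sum_(k <oo) @wlength R idfun (F k) < +oo.
  by rewrite (lt_le_trans sA)// leey.
have lamF k : lebesgue_outer (F k) = @wlength R idfun (F k).
  exact: (measurable_mu_extE (@wlength R idfun) (mF k)).
have [M tailM] : exists M, \sum_(M <= k <oo) @wlength R idfun (F k) <= e%:E.
  have /fine_cvgP[[n1 _ H1] /cvgrPdist_le/(_ _ e0)[n2 _ H2]] :=
    nneseries_tail_cvg fs (fun k _ => F0 k).
  exists (maxn n1 n2); have := H2 (maxn n1 n2) (leq_maxr _ _).
  rewrite sub0r normrN => h; rewrite -(fineK (H1 _ (leq_maxl n1 n2))) lee_fin.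
  by rewrite (le_trans _ h)// ler_norm.
exists (\big[setU/set0]_(k < M) F k); split.
- elim/big_ind: _ => // k _.
  by have [[x y] _ <-] := mF k; exact: fixed_itv.
- apply: le_trans tailM; rewrite -(eq_eseriesr (fun k _ => lamF k)).
  apply: le_trans (outer_measure_sigma_subadditive_tail _ _ _).
  apply: le_outer_measure => x [[Ax nE] x01]; have [k _ Fk] := AF x (conj Ax x01).
  exists k => //= kM; apply: nE; rewrite -(bigcup_mkord M F); by exists k.
- pose U := \bigcup_k F k.
  have hU : lebesgue_outer U <= lebesgue_outer A01 + e%:E.
    apply: le_trans (ltW sA); rewrite -(eq_eseriesr (fun k _ => lamF k)).
    exact: outer_measure_sigma_subadditive.
  (* The criterion for [A01] cuts [U] into [A01] and an excess of outer measure at most [e]. *)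
  rewrite (mA01 U) in hU.
  have UA : U `&` A01 = A01 by apply/setIidPr.
  rewrite UA leeD2lE// in hU; apply: le_trans hU.
  apply: le_outer_measure => x [[+ nA] x01]; rewrite -(bigcup_mkord M F) => -[k _ Fk].
  by split; [exists k|move=> []].
Qed.

Lemma digit_system_rigid :
  rigidity_sequence (digit_system R d0 D_gt1 tau0 tauD tau_far tau_near) u.
Proof.
apply: rigidity_of_moved => A mA; exact: fixed_measurable.
Qed.

End DigitRigidity.

End RigidityCriterion.

(** * The free action and its rigidity along the stages *)

Section RigidSystem.
Local Open Scope ring_scope.

Section FreeRigidSystem.
Context (Gam : zmodType) (Q F : finZmodType).
Variable co : nat -> {additive Gam -> Q}.
Variable pF : {additive Gam -> F}.
Hypothesis co_inj : forall g, pF g = 0 -> (forall i, co i g = 0) -> g = 0.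
Hypothesis co_fin : forall g, exists n, forall i, (n <= i)%N -> co i g = 0.
Variable s : nat -> Gam.

Local Notation D := (bool * Q * F)%type.
Local Notation d0 := ((false, 0, 0) : D).
Local Notation coord := (random_coord co_fin).

Let bits (w : nat -> D) (u : nat) : bool := (w u).1.1.

Section Count.
Variables (k l i t m : nat) (a : Gam).
Hypotheses (stage_a : stage pF co_fin s k l a) (ik : (i < k)%N) (tk : (t < k)%N).
Hypotheses (s_level : at_level co pF (k + l) (s i)) (klm : (k + l <= m)%N).

(** Resamples the bits at the levels from [k] to [k + l - 1]. Each [v] acts as an involution on
    words, so bad words can be counted through the bad [v] for a fixed [w]. *)
Let flip (w : {ffun 'I_m -> D}) (v : {ffun 'I_l -> bool}) : {ffun 'I_m -> D} :=
  [ffun u : 'I_m => ((w u).1.1 (+) ((k <= u)%N && ext_word false v (u - k)),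
                     (w u).1.2, (w u).2)].

Let flipK v : involutive (flip^~ v).
Proof.
move=> w; apply/ffunP => u; rewrite /= !ffunE /= addbK.
by case: (w u) => -[].
Qed.

Let bits_flip w v u : (u < m)%N -> bits (ext_word d0 (flip w v)) u =
  bits (ext_word d0 w) u (+) ((k <= u)%N && ext_word false v (u - k)).
Proof. by move=> um; rewrite /bits /flip !(ext_wordE _ _ um) ffunE. Qed.

(** The ancestor [y0] of level [k] does not depend on [v], while the last [l] bits depend
    injectively on [v]; so the defining bound of the stage at label [i] and node [y0] applies. *)
Let few_flips w c : (c < nnode (level t.+1))%N ->
  (#|[set v | (ev co_fin (c + tail i (bits (ext_word d0 (flip w v))) (level t.+1) (k + l))
       (a - s i) != 0)%R]| <= 2 ^ l %/ k.+1)%N.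
Proof.
move=> clt; have lk : (level t.+1 <= k)%N by rewrite (leq_trans (level_le_id _)).
pose y0 := (c + tail i (bits (ext_word d0 w)) (level t.+1) k)%N.
have y0k : (y0 < nnode k)%N by exact: branch_lt.
pose x (v : {ffun 'I_l -> bool}) : {ffun 'I_l -> bool} :=
  [ffun u : 'I_l => bits (ext_word d0 w) (k + u) (+) v u].
have x_inj : injective x.
  move=> v v' /ffunP e; apply/ffunP => u; have := e u; rewrite !ffunE.
  by case: bits => /= [/negb_inj|].
have evE v : ev co_fin (c + tail i (bits (ext_word d0 (flip w v))) (level t.+1) (k + l))
    (a - s i) = zone_value co_fin k i y0 (x v) (a - s i).
  rewrite branch_zone_node//; last exact: ltnW.
  congr (ev _ _ _); rewrite /zone_node; congr (_ + _)%N.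
    congr (_ + _)%N; apply: eq_big_nat => u /andP[_ uk]; rewrite /letter.
    rewrite bits_flip ?(leq_trans uk) ?(leq_trans _ klm) ?leq_addr//.
    by rewrite leqNgt uk /= addbF.
  apply: eq_bigr => u _; rewrite ext_word_ord ffunE bits_flip; last first.
    by rewrite (leq_trans _ klm)// ltn_add2l.
  by rewrite leq_addr /= addKn ext_word_ord.
have [_ /(_ i y0 ik y0k)] := stage_a; apply: leq_trans.
rewrite -(card_imset _ x_inj).
apply/subset_leq_card/fintype.subsetP => v' /imsetP[v + ->].
by rewrite !inE evE raddfB/= subr_eq0.
Qed.

(** For each [w] at most [2 ^ l %/ k.+1] flips are bad on each of the two branches. Double counting
    the pairs of [w] and [v] leaves a proportion at most [2 / k.+1] of bad words. *)
Lemma card_coord_change :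
  (#|[set w : {ffun 'I_m -> D} | (coord i t (bits (ext_word d0 w)) (a - s i) != 0)%R]|
     * k.+1 <= 2 * #|{: D}| ^ m)%N.
Proof.
set E := [set w | _]%SET.
have lv_g : at_level co pF (k + l) (a - s i).
  by apply: at_levelD; [case: stage_a|exact: at_levelN].
have row w : (#|[set v | flip w v \in E]| <= (2 ^ l %/ k.+1) * 2)%N.
  pose bad c := [set v | ev co_fin
    (c + tail i (bits (ext_word d0 (flip w v))) (level t.+1) (k + l)) (a - s i) != 0].
  apply: (@leq_trans #|bad t.+1 :|: bad (parent t.+1)|).
    apply/subset_leq_card/fintype.subsetP => v; rewrite !inE.
    rewrite (random_coord_level _ _ _ _ lv_g); apply: contraR.
    by rewrite negb_or !negbK => /andP[/eqP-> /eqP->]; rewrite subrr.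
  rewrite (leq_trans (leq_card_setU _ _))// muln2 -addnn leq_add// few_flips//.
    exact: ltn_nnode_level.
  rewrite (leq_trans (parent_lt _))// leq_nnode// leq_pred//.
have total : (#|E| * 2 ^ l = \sum_(w : {ffun 'I_m -> D}) #|[set v | flip w v \in E]|)%N.
  transitivity (\sum_(v : {ffun 'I_l -> bool}) \sum_(w : {ffun 'I_m -> D})
      (flip w v \in E))%N.
    rewrite (eq_bigr (fun=> #|E|)) => [|v _].
      by rewrite sum_nat_const card_ffun card_bool card_ord mulnC.
    rewrite -sum1_card [RHS]big_mkcond [RHS](reindex_inj (inv_inj (flipK v)))/=.
    by apply: eq_bigr => w _; case: (_ \in E).
  rewrite exchange_big/=; apply: eq_bigr => w _; rewrite -sum1_card [RHS]big_mkcond.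
  by apply: eq_bigr => v _; rewrite inE; case: (_ \in E).
have le_total : (#|E| * 2 ^ l <= #|{: D}| ^ m * ((2 ^ l %/ k.+1) * 2))%N.
  rewrite total (leq_trans (leq_sum _ (fun w _ => row w)))// sum_nat_const.
  by rewrite card_ffun card_ord.
rewrite -(leq_pmul2r (_ : 0 < 2 ^ l)%N) ?expn_gt0// mulnAC.
apply: leq_trans (leq_mul le_total (leqnn k.+1)) _.
have := leq_trunc_div (2 ^ l) k.+1; set r := (_ %/ _)%N => rk.
apply: leq_trans (leq_mul (leqnn (2 * #|{: D}| ^ m)%N) rk).
by rewrite leq_eqVlt; apply/orP; left; apply/eqP; set X := (_ ^ m)%N; lia.
Qed.

End Count.

Variable i : nat.

(* A digit consists of a random bit, a coordinate in [Q] and, at position [0] only, a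
   relevant coordinate in [F]. The bits are fixed by the action and choose the branches
   along which [g] is evaluated. *)
Definition spin (g : Gam) (w : nat -> D) (t : nat) : D :=
  ((w t).1.1, (w t).1.2 + coord i t (bits w) g, (w t).2 + pF g *+ (t == 0%N)).

(** At least [1], because position [0] also moves with [pF g]. *)
Definition spin_bound g := maxn 1 (supp_size co_fin g).

Lemma spin0 w : spin 0 w = w.
Proof.
apply/funext => t; rewrite /spin raddf0 mul0rn addr0 random_coord0 ?addr0.
  by case: (w t) => -[].
by move=> j _; exact: raddf0.
Qed.

(** [spin h] keeps the bits, so both factors evaluate along the same branches. *)
Lemma spinD g h w : spin (g + h) w = spin g (spin h w).
Proof.
apply/funext => t; rewrite /spin /= random_coordD raddfD mulrnDl.
by rewrite [coord i t _ g + _]addrC [pF g *+ _ + _]addrC !addrA.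
Qed.

Lemma spin_far g w t : (spin_bound g <= t)%N -> spin g w t = w t.
Proof.
rewrite geq_max => /andP[t0 gt]; rewrite /spin gtn_eqF// mulr0n addr0.
rewrite random_coord0 ?addr0; first by case: (w t) => -[].
by apply: supp_below_le gt _; exact: supp_sizeP.
Qed.

Lemma spin_near g w w' : {in gtn (spin_bound g), w =1 w'} ->
  {in gtn (spin_bound g), spin g w =1 spin g w'}.
Proof.
move=> ww t tg; rewrite /spin ww// (@eq_random_coord _ _ _ _ _ _ _ (bits w'))//.
by move=> u; rewrite inE => ug; rewrite /bits ww// inE (leq_trans ug)// leq_maxr.
Qed.

(** If [pF g] is nonzero, position [0] moves; otherwise the digit at the largest nonzero coordinate
    [t] moves by exactly [co t g]. *)
Lemma spin_free g w : g != 0 -> spin g w <> w.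
Proof.
move=> g0 gw; have [pg|pg] := eqVneq (pF g) 0; last first.
  have := congr1 (fun w => (w 0%N).2) gw; rewrite /spin/= mulr1n => /eqP.
  by rewrite -subr_eq0 addrAC subrr add0r (negbTE pg).
have [t st ct] := exists_top_coord co_inj co_fin pg g0.
have := congr1 (fun w => (w t).1.2) gw; rewrite /spin/= random_coord_top// => /eqP.
by rewrite -subr_eq0 addrAC subrr add0r (negbTE ct).
Qed.

Lemma digit_alphabet_gt1 : (1 < #|{: D}|)%N.
Proof.
rewrite !card_prod card_bool -mulnA.
have cQ : (0 < #|Q|)%N by apply/card_gt0P; exists 0.
have cF : (0 < #|F|)%N by apply/card_gt0P; exists 0.
by rewrite (@leq_trans 2)// leq_pmulr// muln_gt0 cQ.
Qed.

Lemma free_rigid_system (R : realType) (a : nat -> Gam) (st lv : nat -> nat) :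
  (forall K, exists n0, forall n, (n0 <= n)%N -> (K <= st n)%N) ->
  (forall n, stage pF co_fin s (st n) (lv n) (a n)) ->
  (forall n, (i < st n)%N -> at_level co pF (st n + lv n) (s i)) ->
  exists S : system R Gam, free_system S /\ rigidity_sequence S (fun n => a n - s i).
Proof.
move=> st_oo stage_a s_level.
exists (digit_system R d0 digit_alphabet_gt1 spin0 spinD spin_far spin_near).
split; first by apply: digit_system_free; exact: spin_free.
apply: digit_system_rigid => N e e0.
(* [i < k] makes the stage control label [i], [N <= k] covers every position [t < N], and the last
   term gives [2 N / k.+1 <= e], the union bound over these positions. *)
pose K := maxn i.+1 (maxn N (Num.truncn ((2 * N)%:R / e))).
have [n0 H] := st_oo K; exists n0 => n /H; rewrite !geq_max => /and3P[ik Nk ek].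
set k := st n in ik Nk ek; set g := a n - s i.
exists (maxn (spin_bound g) (k + lv n)); first exact: leq_maxl.
set m := maxn _ _; have klm : (k + lv n <= m)%N by exact: leq_maxr.
have lv_s := s_level n ik.
set E := (X in #|X|%:R).
pose Et (t : 'I_N) :=
  [set w : {ffun 'I_m -> D} | coord i t (bits (ext_word d0 w)) g != 0].
have pg : pF g = 0.
  by rewrite raddfB/= (proj1 lv_s) (proj1 (proj1 (stage_a n))) subrr.
have cardE : (#|E| <= \sum_(t < N) #|Et t|)%N.
  apply: (@leq_trans #|\bigcup_(t < N) Et t|).
    apply/subset_leq_card/fintype.subsetP => w; rewrite inE => /existsP[t wt].
    apply/bigcupP; exists t => //; rewrite inE; apply: contraNN wt => /eqP ct.
    rewrite /spin ct pg mul0rn !addr0; by case: (ext_word _ _ _) => -[].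
  elim/big_rec2: _ => [|t c A _ IH]; first by rewrite cards0.
  by rewrite (leq_trans (leq_card_setU _ _))// leq_add2l.
have cardEk : (#|E| * k.+1 <= N * (2 * #|{: D}| ^ m))%N.
  apply: leq_trans (leq_mul cardE (leqnn _)) _; rewrite big_distrl/=.
  rewrite -[N in (_ <= N * _)%N]card_ord -sum_nat_const; apply: leq_sum => t _.
  by apply: (card_coord_change (stage_a n)) => //; exact: leq_trans (ltn_ord t) Nk.
have b0 : 0 < #|{: D}|%:R ^+ m :> R.
  by rewrite exprn_gt0// ltr0n ltnW// digit_alphabet_gt1.
rewrite ler_pdivrMr// -(ler_pM2r (ltr0Sn R k)) -natrM.
apply: (@le_trans _ _ (N * (2 * #|{: D}| ^ m))%:R); first by rewrite ler_nat.
rewrite mulnA natrM natrX mulrAC ler_pM2r// mulnC.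
rewrite mulrC -ler_pdivrMr// (le_trans (ltW (truncnS_gt _)))// ler_nat ltnS.
exact: ek.
Qed.

End FreeRigidSystem.

End RigidSystem.

(** * Assembly *)

Section Translates.
Local Open Scope ring_scope.

(** Concatenate the lists; [st n] is the largest number of complete lists fitting in the first [n]
    terms. Nonempty lists make every position occur. *)
Lemma enumerate_blocks (T : eqType) (L : nat -> seq T) :
  (forall k, exists x, x \in L k) ->
  exists a st, [/\ forall n, a n \in L (st n),
    forall K, exists n0, forall n, (n0 <= n)%N -> (K <= st n)%N &
    forall k x, x \in L k -> exists n, a n = x].
Proof.
move=> Lne; have [x0 _] := Lne 0%N.
pose B n := flatten [seq L k | k <- iota 0 n].
have BS n : B n.+1 = B n ++ L n.
  by rewrite /B -addn1 iotaD map_cat flatten_cat /= cats0.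
have sizeB n : (n <= size (B n))%N.
  elim: n => // n IH; rewrite BS size_cat -addn1 leq_add//.
  by have [x] := Lne n; case: (L n).
have nthB i m n : (m <= n)%N -> (i < size (B m))%N -> nth x0 (B n) i = nth x0 (B m) i.
  move=> mn im; elim: n mn => [|n IH]; first by rewrite leqn0 => /eqP->.
  rewrite leq_eqVlt => /orP[/eqP<-//|]; rewrite ltnS => mn.
  rewrite BS nth_cat ifT; first exact: IH.
  apply: leq_trans im _; elim: n mn {IH} => [|n IH]; first by rewrite leqn0 => /eqP->.
  rewrite leq_eqVlt => /orP[/eqP<-//|]; rewrite ltnS => mn.
  by rewrite BS size_cat (leq_trans (IH mn))// leq_addr.
pose a n := nth x0 (B n.+1) n.
have /choice[st stP] n : exists k, a n \in L k /\
    forall K, (size (B K) <= n)%N -> (K <= k)%N.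
  have ex0 : exists K, (size (B K) <= n)%N by exists 0%N.
  have ub K : (size (B K) <= n)%N -> (K <= n)%N by exact: leq_trans (sizeB K).
  have [k kn kmax] := ex_maxnP ex0 ub; exists k; split => //.
  have kn1 : (n < size (B k.+1))%N by rewrite ltnNge; apply/negP => /kmax; rewrite ltnn.
  have -> : a n = nth x0 (B k.+1) n by apply: nthB => //; rewrite ltnS ub.
  rewrite BS nth_cat ltnNge kn /=; apply: mem_nth.
  by rewrite ltn_subLR// -size_cat -BS.
exists a, st; split=> [n|K|k x xk]; first by have [] := stP n.
  by exists (size (B K)) => n nK; have [_] := stP n; apply.
have xB : x \in B k.+1 by rewrite BS mem_cat xk orbT.
exists (index x (B k.+1)); rewrite /a.
have lt : (index x (B k.+1) < size (B k.+1))%N by rewrite index_mem.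
have [le|/ltnW le] := leqP k.+1 (index x (B k.+1)).+1.
  by rewrite (nthB _ _ _ le lt) nth_index.
by rewrite -(nthB _ _ _ le (sizeB _)) nth_index.
Qed.

Section Assembly.
Context (R : realType) (Gam : zmodType) (Q F : finZmodType).
Variables (co : nat -> {additive Gam -> Q}) (un : nat -> {additive Q -> Gam}).
Variable pF : {additive Gam -> F}.
Hypothesis co_un : forall i j v, co j (un i v) = v *+ (i == j).
Hypothesis pF_un : forall i v, pF (un i v) = 0.
Hypothesis co_inj : forall g, pF g = 0 -> (forall i, co i g = 0) -> g = 0.
Hypothesis co_fin : forall g, exists n, forall i, (n <= i)%N -> co i g = 0.
Variable q1 : Q.
Hypothesis q1_neq0 : q1 != 0.
Hypothesis Gam_countable : countable [set: Gam]%classic.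

Lemma enumerate_kernel : exists s : nat -> Gam,
  (forall i, pF (s i) = 0) /\ forall g, pF g = 0 -> exists i, s i = g.
Proof.
have /countable_injP[f f_inj] := Gam_countable.
have /choice[s sP] i : exists g, pF g = 0 /\ forall g', pF g' = 0 -> f g' = i -> g = g'.
  have [[g [g0 gi]]|no] := pselect (exists g, pF g = 0 /\ f g = i).
    exists g; split => // g' _ g'i; apply: f_inj; rewrite ?inE//.
    by rewrite gi g'i.
  exists 0; split; first exact: raddf0.
  by move=> g' g'0 g'i; case: no; exists g'.
exists s; split => [i|g g0]; first by have [] := sP i.
by exists (f g); have [_] := sP (f g); apply.
Qed.

(** An element of a stage is determined by its values at the finitely many nodes of level
    [k + l]. *)
Lemma stage_seq (s : nat -> Gam) k l :
  exists L : seq Gam, forall a, a \in L <-> stage pF co_fin s k l a.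
Proof.
pose n := (k + l)%N.
pose v (f : {ffun 'I_(nnode n) -> Q}) y := ext_word 0 f y.
exists [seq a <- [seq of_values un n (v f) | f : {ffun 'I_(nnode n) -> Q}]
  | `[< stage pF co_fin s k l a >]] => a.
rewrite mem_filter; split=> [/andP[/asboolP//]|sa].
apply/andP; split; first exact/asboolP.
apply/mapP; exists [ffun y : 'I_(nnode n) => ev co_fin y a]; first exact: mem_enum.
rewrite {1}(at_level_of_values co_un pF_un co_inj co_fin sa.1).
apply: eq_bigr => i _; have i1 : (i.+1 < nnode n)%N.
  by have := ltn_ord i; rewrite -/n; lia.
rewrite /v !(ext_word_finfun 0 (fun y => ev co_fin y a))//.
exact: ltn_trans (parent_ltn _) i1.
Qed.

Lemma freely_rigid_recurrent_translates : exists a : nat -> Gam,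
  forall g, pF g = 0 -> freely_rigid_recurrent R (fun n => a n - g).
Proof.
have [s [s0 s_surj]] := enumerate_kernel.
(* The first summand gives the growth condition of [stage_density], by [n < 2 ^ n]; the second puts
   each [s j] with [j < k] at level [k + lv k]; the third gives positivity. *)
pose lv k := (4 * k.+1 ^ 4 * nnode k + \sum_(j < k) supp_size co_fin (s j) + 1)%N.
have lv_gt0 k : (0 < lv k)%N by rewrite /lv addn1.
have lv_large k : (4 * k.+1 ^ 4 * nnode k <= 2 ^ lv k)%N.
  apply: leq_trans (ltnW (ltn_expl (lv k) (ltnSn 1))).
  by rewrite /lv -addnA leq_addr.
have s_level k j : (j < k)%N -> at_level co pF (k + lv k) (s j).
  move=> jk; split; first exact: s0.
  apply: supp_below_le (@supp_sizeP _ _ _ co_fin (s j)).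
  have := nnode_gt (k + lv k).
  have : (supp_size co_fin (s j) <= lv k)%N.
    by rewrite /lv (bigD1 (Ordinal jk))//= addnCA -addnA leq_addr.
  lia.
have /choice[L LP] k := stage_seq s k.+1 (lv k.+1).
have Lne k : exists x, x \in L k.
  have [x xs] := @stage_nonempty _ _ _ _ _ _ co_un pF_un co_fin _ q1_neq0 s
    k.+1 (lv k.+1) (lv_gt0 _) (s_level _) (ltn0Sn k).
  by exists x; apply/LP.
have [a [st [aL st_oo a_surj]]] := enumerate_blocks Lne.
exists a => g g0; have [i <-] := s_surj g g0; split.
  apply: (@free_rigid_system _ _ _ _ _ co_inj co_fin s i R a
    (fun n => (st n).+1) (fun n => lv (st n).+1)).
  - by move=> K; have [n0 H] := st_oo K; exists n0 => n /H /leqW.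
  - by move=> n; apply/LP.
  - by move=> n; exact: s_level.
apply: (@set_of_recurrence_criterion R Gam Q) => e e0.
(* A single stage suffices: its index [k.+1] exceeds [i], and its density bound [k.+2%:R^-1] is at
   most [e]. *)
pose k := (maxn i (Num.truncn e^-1)).
have ik : (i < k.+1)%N by rewrite ltnS leq_maxl.
exists (direction un (k.+1 + lv k.+1)), (nnode (k.+1 + lv k.+1)).-1 => al avoid.
apply: le_trans (_ : _ <= k.+2%:R^-1) _.
  apply: (stage_density R co_un pF_un co_inj q1_neq0 (lv_gt0 _) (lv_large _)
    (s_level k.+1) ik) => g1 x sx xs.
  have [n xE] := a_surj k x ((LP k x).2 sx); subst x.
  by apply: avoid; rewrite subr_eq0.
rewrite -[leRHS]invrK lef_pV2 ?posrE ?invr_gt0// (le_trans (ltW (truncnS_gt _)))//.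
by rewrite ler_nat ltnS leqW// leq_maxr.
Qed.

End Assembly.

End Translates.

Local Open Scope classical_set_scope.
Local Open Scope ring_scope.

(** * Coordinates of the given group and conclusion *)

Section FiniteProduct.
Context (I : finType) (A : I -> finZmodType).

Definition fin_prod : Type := {dffun forall i, A i}.
HB.instance Definition _ := Finite.on fin_prod.
Implicit Types x y : fin_prod.

Definition fin_prod0 : fin_prod := finfun (fun i => 0 : A i).
Definition fin_prodN x : fin_prod := finfun (fun i => - x i : A i).
Definition fin_prodD x y : fin_prod := finfun (fun i => x i + y i : A i).

Fact fin_prodDA : associative fin_prodD.
Proof. by move=> x y z; apply/ffunP => i; rewrite !ffunE addrA. Qed.
Fact fin_prodDC : commutative fin_prodD.
Proof. by move=> x y; apply/ffunP => i; rewrite !ffunE addrC. Qed.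
Fact fin_prod0D : left_id fin_prod0 fin_prodD.
Proof. by move=> x; apply/ffunP => i; rewrite !ffunE add0r. Qed.
Fact fin_prodND : left_inverse fin_prod0 fin_prodN fin_prodD.
Proof. by move=> x; apply/ffunP => i; rewrite !ffunE addNr. Qed.

HB.instance Definition _ :=
  GRing.isZmodule.Build fin_prod fin_prodDA fin_prodDC fin_prod0D fin_prodND.

Lemma fin_prodBE x y i : (x - y) i = x i - y i.
Proof. by rewrite ffunE ffunE. Qed.

Lemma fin_prod0E i : (0 : fin_prod) i = 0.
Proof. by rewrite ffunE. Qed.

End FiniteProduct.

Section Coordinates.
Context (Gam : zmodType) (M N : nat) (r m : 'I_M -> nat) (q : 'I_N -> nat).
Variable phi : {additive Gam ->
     (dirsum (fun k : 'I_M => {ffun 'I_(m k) -> 'Z_(r k)})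
      * dirsum (fun j : 'I_N => dirsum_Z (q j)))%type}.
Variable psi : (dirsum (fun k : 'I_M => {ffun 'I_(m k) -> 'Z_(r k)})
  * dirsum (fun j : 'I_N => dirsum_Z (q j)))%type -> Gam.
Hypotheses (phiK : cancel phi psi) (psiK : cancel psi phi).

(** Regrouping the [n]-th coordinates of all [N] infinite sums turns them into one countable sum of
    copies of this finite group. *)
Definition infinite_index : finZmodType :=
  fin_prod (fun j : 'I_N => 'Z_(q j) : finZmodType).
Definition finite_index : finZmodType :=
  fin_prod (fun p : {k : 'I_M & 'I_(m k)} => 'Z_(r (tag p)) : finZmodType).

Definition coord_at n (g : Gam) : infinite_index :=
  finfun (fun j => (phi g).2 j n : 'Z_(q j)).

Fact coord_at_is_zmod_morphism n : zmod_morphism (coord_at n).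
Proof. by move=> x y; apply/ffunP => j; rewrite fin_prodBE !ffunE raddfB. Qed.
HB.instance Definition _ n := GRing.isZmodMorphism.Build Gam infinite_index (coord_at n)
  (coord_at_is_zmod_morphism n).

Definition finite_part (g : Gam) : finite_index :=
  finfun (fun p => (phi g).1 (tag p) (tagged p) : 'Z_(r (tag p))).

Fact finite_part_is_zmod_morphism : zmod_morphism finite_part.
Proof. by move=> x y; apply/ffunP => p; rewrite fin_prodBE !ffunE raddfB/= !ffunE. Qed.
HB.instance Definition _ := GRing.isZmodMorphism.Build Gam finite_index finite_part
  finite_part_is_zmod_morphism.

Fact single_coord_fin (p n : nat) (z : 'Z_p) :
  finite_set [set k | (if k == n then z else 0) != 0].
Proof.
apply: (@sub_finite_set _ _ [set n]); last exact: finite_set1.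
by move=> k /=; case: (k =P n) => // _; rewrite eqxx.
Qed.

Definition single_coord p n (z : 'Z_p) : dirsum_Z p := DirSum (single_coord_fin n z).

Fact unit_at_fin n (v : infinite_index) :
  finite_set [set j : 'I_N | single_coord n (v j : 'Z_(q j)) != 0].
Proof. exact: finite_finset. Qed.

Definition unit_at n (v : infinite_index) : Gam := psi (0, DirSum (unit_at_fin n v)).

Lemma coord_at_unit i k v : coord_at k (unit_at i v) = v *+ (i == k).
Proof.
apply/ffunP => j; rewrite ffunE psiK /= eq_sym.
by case: (i == k); rewrite ?mulr0n ?mulr1n ?fin_prod0E.
Qed.

Lemma finite_part_unit i v : finite_part (unit_at i v) = 0.
Proof. by apply/ffunP => p; rewrite ffunE psiK /= fin_prod0E ffunE. Qed.

Lemma finite_part_eq0 g : finite_part g = 0 <-> (phi g).1 = 0.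
Proof.
split=> [g0|g0]; last by apply/ffunP => p; rewrite ffunE g0 fin_prod0E ffunE.
apply: dirsum_ext => k; apply/ffunP => i; rewrite [RHS]ffunE.
have := congr1 (fun x : finite_index => x (Tagged (fun k => 'I_(m k)) i)) g0.
by rewrite fin_prod0E ffunE.
Qed.

Lemma coord_at_inj g : finite_part g = 0 -> (forall i, coord_at i g = 0) -> g = 0.
Proof.
move=> /finite_part_eq0 g1 g2; rewrite -[g]phiK -[0]phiK raddf0; congr (psi _).
rewrite [phi g]surjective_pairing g1; congr (_, _).
apply: dirsum_ext => j; apply: dirsum_ext => i.
have := congr1 (fun x : infinite_index => x j) (g2 i).
by rewrite fin_prod0E ffunE.
Qed.

Fact unit_at_is_zmod_morphism n : zmod_morphism (unit_at n).
Proof.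
move=> x y; apply/eqP; rewrite -subr_eq0; apply/eqP/coord_at_inj.
  by rewrite !raddfB/= !finite_part_unit !subrr addr0.
move=> i; rewrite !raddfB/= !coord_at_unit mulrnBl.
by rewrite opprK addrACA subrr addNr addr0.
Qed.

(* Not a canonical instance: additivity of [psi] depends on [phiK] and [psiK]. *)
Definition unit_additive n : {additive infinite_index -> Gam} :=
  HB.pack (unit_at n) (GRing.isZmodMorphism.Build infinite_index Gam (unit_at n)
    (unit_at_is_zmod_morphism n)).

Lemma coord_at_fin g : exists n, forall i, (n <= i)%N -> coord_at i g = 0.
Proof.
have /choice[b bP] (j : 'I_N) : exists n, forall i, (n <= i)%N -> (phi g).2 j i = 0.
  have /finite_seqP[t tE] := dscoord_fin ((phi g).2 j).
  exists (\max_(i <- t) i).+1 => i ti; apply/eqP; apply: contraTT ti => gi.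
  have : [set` t] i by rewrite -tE.
  by rewrite /= -leqNgt => it; rewrite (@leq_bigmax_seq _ t xpredT id i it).
exists (\max_j b j) => i bi; apply/ffunP => j; rewrite fin_prod0E ffunE; apply: bP.
exact: leq_trans (leq_bigmax j) bi.
Qed.

End Coordinates.

Theorem theorem7p11 (R : realType) (Gam : zmodType)
  (Gam_countable : countable [set: Gam])
  (Gam_exponent : exists e : nat, (0 < e)%N /\ forall g : Gam, g *+ e = 0)
  (M N : nat) (hN : (1 <= N)%N)
  (r m : 'I_M -> nat) (q : 'I_N -> nat)
  (hr : forall k, prime_power (r k)) (hq : forall j, prime_power (q j))
  (hrq : uniq (codom r ++ codom q))
  (phi : {additive Gam ->
     (dirsum (fun k : 'I_M => {ffun 'I_(m k) -> 'Z_(r k)})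
      * dirsum (fun j : 'I_N => dirsum_Z (q j)))%type})
  (hphi : bijective phi)
  (hD : forall j, Dq_kronecker_generated R (q j)) :
  exists a : nat -> Gam,
    forall s : Gam, (phi s).1 = 0 ->
      freely_rigid_recurrent R (fun n => a n - s).
Proof.
have [psi phiK psiK] := hphi.
(* [1] is nonzero in every ['Z_n], and [hN] supplies a component at which [q1] is seen to be
   nonzero. *)
pose q1 : infinite_index q := finfun (fun j => 1 : 'Z_(q j)).
have q1_neq0 : q1 != 0.
  apply/eqP => /(congr1 (fun x : infinite_index q => x (Ordinal hN))).
  by rewrite fin_prod0E ffunE.
have [a ha] := @freely_rigid_recurrent_translates R Gam _ _ (@coord_at Gam M N r m q phi)
  (unit_additive phiK psiK) (finite_part phi) (coord_at_unit psiK)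
  (finite_part_unit psiK) (coord_at_inj phiK) (coord_at_fin phi) q1 q1_neq0 Gam_countable.
by exists a => s /finite_part_eq0; exact: ha.
Qed.
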